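(* Let $\epsilon>0$ and suppose $\sigma_e>\sigma_0$ for all $e\in\mathcal{E}_h^I$. If the time step satisfies $k<2\epsilon^2$, then there exists a unique solution of the fully discrete scheme: given $u^0\in V_h$, there is a unique sequence $u^1,\dots,u^M\in V_h$ such that for $0\le m\le M-1$ $$\Big(\frac{u^{m+1}-u^{m}}{k},v_h\Big)_{\mathcal{T}_h}+a_h\Big(\frac{u^{m+1}+u^m}{2},v_h\Big)+\frac{1}{\epsilon^2}\big(f^{m+1},v_h\big)_{\mathcal{T}_h}=0\qquad\forall v_h\in V_h.$$
   Context: $\Omega\subset\mathbb{R}^d$ ($d=2,3$) is a bounded polygonal or polyhedral domain, $\mathcal{T}_h$ is a quasi-uniform triangulation of $\Omega$ with mesh size $h=\max_K h_K$, $h_K=\mathrm{diam}\,K$. $V_h=\prod_{K\in\mathcal{T}_h}P_r(K)$ is the space of (discontinuous) piecewise polynomials of degree at most $r$ ($r\ge1$ an integer). $\mathcal{E}_h^I$ is the set of interior faces/edges, $h_e$ the diameter of $e$. $(u,v)_{\mathcal{T}_h}=\sum_{K}\int_K uv\,dx$, $\langle u,v\rangle_{\mathcal{E}_h^I}=\sum_{e\in\mathcal{E}_h^I}\int_e uv\,ds$, $\langle u,v\rangle_e=\int_e uv\,ds$. For an interior face $e=\partial K\cap\partial K'$ with the global label of $K$ smaller than that of $K'$, the unit normal is $n_e=n_K|_e$ (outward from $K$), $[v]=v|_K-v|_{K'}$, $\{v\}=\frac12(v|_K+v|_{K'})$, and $\partial_n$ is the derivative in direction $n_e$. The bilinear form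 is $$a_h(u,v)=(\nabla u,\nabla v)_{\mathcal{T}_h}-\langle\{\partial_n u\},[v]\rangle_{\mathcal{E}_h^I}+\lambda\langle[u],\{\partial_n v\}\rangle_{\mathcal{E}_h^I}+j_h(u,v),\qquad j_h(u,v)=\sum_{e\in\mathcal{E}_h^I}\frac{\sigma_e}{h_e}\langle[u],[v]\rangle_e,$$ with $\lambda\in\{-1,0,1\}$ and $\sigma_e>0$ constant on each $e$ (gradients elementwise). The constants $\sigma_0,\alpha>0$ are such that, whenever $\sigma_e>\sigma_0$ for all $e$, one has $\Phi^h(v_h)\ge\alpha\big(\|\nabla v_h\|_{L^2(\mathcal{T}_h)}^2+j_h(v_h,v_h)\big)$ for all $v_h\in V_h$, where $\Phi^h(v)=\frac12\|\nabla v\|_{L^2(\mathcal{T}_h)}^2-\langle\{\partial_n v\},[v]\rangle_{\mathcal{E}_h^I}+\frac12 j_h(v,v)$. Such constants exist (known coercivity lemma). The nonlinear term is $$f^{m+1}=\frac14\big[(u^{m+1})^3+(u^{m+1})^2u^m+u^{m+1}(u^m)^2+(u^m)^3\big]-\frac{u^{m+1}+u^m}{2},$$ and $k=T/M$ is the time step. *)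

(* Defs.v *)
From HB Require Import structures.
From mathcomp Require Import all_boot all_order all_algebra.
From mathcomp Require Import all_classical all_reals all_analysis.
From mathcomp Require mpoly.

Set Implicit Arguments.
Unset Strict Implicit.
Unset Printing Implicit Defensive.
Import Order.TTheory GRing.Theory Num.Theory.
Import numFieldNormedType.Exports.
Local Open Scope classical_set_scope.
Local Open Scope ring_scope.

(* Lebesgue measure on R^m, built as an iterated product on m.-tuple R. *)
Section LebesgueTuple.
Context {R : realType}.
Local Notation R' := (measurableTypeR R).

Definition cons_pair m (x : R' * m.-tuple R') : m.+1.-tuple R' :=
  [the m.+1.-tuple R' of x.1 :: x.2].

Lemma measurable_cons_pair m :
  measurable_fun [set: R' * m.-tuple R'] (@cons_pair m).
Proof. exact: measurable_cons. Qed.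

Section LebesgueStep.
Local Open Scope ereal_scope.
Variables (m : nat) (mu : {sigma_finite_measure set (m.-tuple R') -> \bar R}).

Definition lebesgue_step : set (m.+1.-tuple R') -> \bar R :=
  pushforward (@lebesgue_measure R \x mu) (@cons_pair m).

Let step0 : lebesgue_step set0 = 0.
Proof. by rewrite /lebesgue_step /pushforward preimage_set0 measure0. Qed.

Let step_ge0 A : 0 <= lebesgue_step A.
Proof. by rewrite /lebesgue_step /pushforward; apply: measure_ge0. Qed.

Let mpre A : measurable A -> measurable (@cons_pair m @^-1` A).
Proof.
by move=> mA; rewrite -[X in measurable X]setTI; exact: measurable_cons_pair.
Qed.

Let step_sigma_additive : semi_sigma_additive lebesgue_step.
Proof.
move=> F mF tF mUF; rewrite /lebesgue_step /pushforward preimage_bigcup.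
apply: measure_semi_sigma_additive.
- by move=> n; exact: mpre.
- apply/trivIsetP => /= i j _ _ ij; rewrite -preimage_setI.
  by move/trivIsetP : tF => /(_ _ _ _ _ ij) ->//; rewrite preimage_set0.
- by rewrite -preimage_bigcup; exact: mpre.
Qed.

HB.instance Definition _ := isMeasure.Build _ _ _ lebesgue_step
  step0 step_ge0 step_sigma_additive.

Let step_sigma_finite : sigma_finite setT lebesgue_step.
Proof.
have /sigma_finiteP[F [TF ndF Foo]] :=
  sigma_finiteT (@lebesgue_measure R : {sigma_finite_measure set _ -> \bar R}).
have /sigma_finiteP[G [TG ndG Goo]] := sigma_finiteT mu.
exists (fun n => [set t | F n (thead t) /\ G n [tuple of behead t]]).
  apply/esym; rewrite -subTset => t _.
  have [i _ Fi] : (\bigcup_i F i) (thead t) by rewrite -TF.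
  have [j _ Gj] : (\bigcup_i G i) [tuple of behead t] by rewrite -TG.
  exists (maxn i j) => //=; split.
    by move: Fi; apply/subsetPset/ndF/leq_maxl.
  by move: Gj; apply/subsetPset/ndG/leq_maxr.
move=> n; have [mF Fn] := Foo n; have [mG Gn] := Goo n; split.
  apply: measurableI.
    by rewrite -[X in measurable X]setTI; exact: (measurable_tnth ord0).
  by rewrite -[X in measurable X]setTI; exact: measurable_behead.
rewrite /lebesgue_step /pushforward.
rewrite (_ : _ @^-1` _ = F n `*` G n).
  by rewrite product_measure1E// lte_mul_pinfty// ge0_fin_numE.
apply/seteqP; split => -[x t] /= [Fx Gt]; split => //.
  by rewrite (_ : t = [tuple of behead (cons_pair (x, t))])//; exact/val_inj.
by rewrite (_ : [tuple of _] = t)//; exact/val_inj.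
Qed.

HB.instance Definition _ := Measure_isSigmaFinite.Build _ _ _ lebesgue_step
  step_sigma_finite.
End LebesgueStep.

Fixpoint lebesgue_tuple m : {sigma_finite_measure set (m.-tuple R') -> \bar R} :=
  if m is m'.+1 then lebesgue_step (lebesgue_tuple m')
  else \d_[tuple].
End LebesgueTuple.

(* The notations of mpoly, and its isMeasure, clash with those of the analysis
   library; only the rest is imported, and only from here on. *)
Import -(notations) mpoly.

Section Geometry.
Context {R : realType} {d : nat}.
Local Notation V := 'rV[R]_d.

Definition dot (x y : V) : R := \sum_i x 0 i * y 0 i.

(* The library norm `|x| on row vectors is the max norm. *)
Definition enorm (x : V) : R := Num.sqrt (dot x x).

Definition diam (A : set V) : R :=
  sup [set r | exists x y, [/\ A x, A y & r = enorm (x - y)]].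

(* The convex hull of the points w i with P i. *)
Definition hull m (w : 'I_m -> V) (P : pred 'I_m) : set V :=
  [set x | exists2 t : 'I_m -> R,
     [/\ forall i, 0 <= t i, forall i, ~~ P i -> t i = 0 & \sum_i t i = 1] &
     x = \sum_i t i *: w i].

Definition simplex m (w : 'I_m -> V) : set V := hull w predT.

Definition open_simplex m (w : 'I_m -> V) : set V :=
  [set x | exists2 t : 'I_m -> R,
     (forall i, 0 < t i) /\ \sum_i t i = 1 & x = \sum_i t i *: w i].

Definition edge_mx m (w : 'I_m.+1 -> V) : 'M[R]_(m, d) :=
  \matrix_j (w (lift ord0 j) - w ord0).

Definition affinely_independent m (w : 'I_m.+1 -> V) := row_free (edge_mx w).

Definition row_of_tuple (t : d.-tuple (measurableTypeR R)) : V :=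
  \row_i (tnth t i : R).

Definition volume_int (A : set V) (f : V -> R) : R :=
  \int[@lebesgue_tuple R d]_(t in [set t | A (row_of_tuple t)])
    f (row_of_tuple t).

(* The integral over an m-simplex in R^d with respect to its m-dimensional
   surface measure, through the affine parametrization
   t |-> w_0 + \sum_j t_j (w_(j+1) - w_0) of the simplex by the unit simplex
   of R^m, whose area element is the square root of the Gram determinant. *)
Definition unit_simplex m : set (m.-tuple (measurableTypeR R)) :=
  [set t | (forall j, 0 <= (tnth t j : R)) /\ \sum_j (tnth t j : R) <= 1].

Definition surface_int m (w : 'I_m.+1 -> V) (f : V -> R) : R :=
  Num.sqrt (\det (edge_mx w *m (edge_mx w)^T)) *
  \int[@lebesgue_tuple R m]_(t in @unit_simplex m)
    f (w ord0 + \sum_j (tnth t j : R) *: (w (lift ord0 j) - w ord0)).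

Section Faces.
Variable w : 'I_d.+1 -> V.

(* The vertices of the face of w opposite to w i; bump i enumerates the
   indices other than i, and d.-1.+1 = d as soon as 0 < d. *)
Definition face_vertex (i : 'I_d.+1) : 'I_d.-1.+1 -> V :=
  fun j => w (inord (bump i j)).

Definition is_outward_normal (i : 'I_d.+1) (nu : V) : Prop :=
  [/\ enorm nu = 1,
      forall j j', j != i -> j' != i -> dot nu (w j - w j') = 0 &
      forall j, j != i -> dot nu (w i - w j) < 0].

Definition outward_normal (i : 'I_d.+1) : V :=
  xget 0 (is_outward_normal i).

End Faces.

Lemma dotZl a (x y : V) : dot (a *: x) y = a * dot x y.
Proof. by rewrite mulr_sumr; apply: eq_bigr => i _; rewrite mxE mulrA. Qed.

Lemma outward_normalP (w : 'I_d.+1 -> V) (i : 'I_d.+1) :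
  (0 < d)%N -> affinely_independent w ->
  is_outward_normal w i (outward_normal w i).
Proof.
move=> d0 wfree.
have Eu : edge_mx w \in unitmx by rewrite -row_free_unit.
pose L (j : 'I_d.+1) : R := - (j == i)%:R.
pose c : 'cV[R]_d := \col_j (L (lift ord0 j) - L ord0).
pose q : V := (invmx (edge_mx w) *m c)^T.
have q0 (j : 'I_d.+1) : dot q (w j - w ord0) = L j - L ord0.
  case: (unliftP ord0 j) => [k ->|->].
    have -> : L (lift ord0 k) - L ord0 = (edge_mx w *m q^T) k 0.
      by rewrite trmxK mulKVmx// mxE.
    rewrite mxE; apply: eq_bigr => l _; rewrite [q^T l 0]mxE.
    have -> : edge_mx w k l = (w (lift ord0 k) - w ord0) 0 l by rewrite mxE.
    exact: mulrC.
  by rewrite !subrr /dot big1// => l _; rewrite [X in _ * X]mxE mulr0.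
clearbody q; have qE j j' : dot q (w j - w j') = L j - L j'.
  have -> : dot q (w j - w j') = dot q (w j - w ord0) - dot q (w j' - w ord0).
    rewrite -sumrB; apply: eq_bigr => l _; rewrite -mulrBr !mxE.
    by congr (_ * _); rewrite opprB addrA subrK.
  by rewrite !q0 opprB addrA subrK.
have qq0 : 0 < dot q q.
  have dot_ge0 (x : V) : 0 <= dot x x.
    by apply: sumr_ge0 => l _; rewrite -expr2 sqr_ge0.
  rewrite lt_neqAle dot_ge0 andbT eq_sym; apply/negP => /eqP qq.
  have qz l : q 0 l = 0.
    apply/eqP; rewrite -sqrf_eq0 expr2; apply/eqP; move: l isT.
    by apply: psumr_eq0P qq => k _; rewrite -expr2 sqr_ge0.
  have := qE i (if i == ord0 then inord 1 else ord0).
  rewrite /dot big1 => [|l _]; last by rewrite qz mul0r.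
  rewrite /L eqxx; case: (eqVneq i ord0) => [->|i0].
    have -> : (inord 1 == ord0 :> 'I_d.+1) = false.
      by apply/negbTE/eqP => /(congr1 val); rewrite /= inordK.
    by move/esym/eqP; rewrite oppr0 subr0 oppr_eq0 oner_eq0.
  rewrite [ord0 == i]eq_sym (negbTE i0).
  by move/esym/eqP; rewrite oppr0 subr0 oppr_eq0 oner_eq0.
have ex : is_outward_normal w i ((enorm q)^-1 *: q).
  have n0 : 0 < enorm q by rewrite sqrtr_gt0.
  split.
  - rewrite /enorm dotZl.
    have -> : dot q ((enorm q)^-1 *: q) = (enorm q)^-1 * dot q q.
      by rewrite -dotZl /dot; apply: eq_bigr => l _; rewrite mulrC.
    rewrite mulrA -expr2 exprVn sqr_sqrtr ?ltW// mulVf ?sqrtr1//.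
    by rewrite gt_eqF.
  - move=> j j' ji j'i.
    by rewrite dotZl qE /L (negbTE ji) (negbTE j'i) subrr mulr0.
  - move=> j ji; rewrite dotZl qE /L eqxx (negbTE ji) oppr0 subr0 mulrN1.
    by rewrite oppr_lt0 invr_gt0.
exact: (xgetPex 0 (ex_intro _ _ ex)).
Qed.

End Geometry.

(* The order of the elements 'I_(nelt Th) is the global labelling. *)
Record mesh (R : realType) (d : nat) := Mesh {
  nelt : nat;
  vertex : 'I_nelt -> 'I_d.+1 -> 'rV[R]_d }.

Section Mesh.
Context {R : realType} {d : nat}.
Local Notation V := 'rV[R]_d.
Implicit Types (Om : set V) (Th : mesh R d).

Definition elt Th (K : 'I_(nelt Th)) : set V := simplex (@vertex R d Th K).

Definition polytopal_domain Om : Prop :=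
  [/\ Om !=set0, open Om, connected Om, bounded_set Om &
      exists N (w : 'I_N -> 'I_d.-1.+1 -> V),
        (forall i, affinely_independent (w i)) /\
        closure Om `\` Om = \bigcup_i simplex (w i)].

Record is_triangulation Om Th : Prop := IsTriangulation {
  tri_simplex : forall K : 'I_(nelt Th), affinely_independent (vertex K);
  tri_cover : closure Om = \bigcup_K @elt Th K;
  tri_sub : forall K : 'I_(nelt Th), open_simplex (vertex K) `<=` Om;
  tri_inj : injective (@elt Th);
  (* two elements meet in the face, possibly empty, spanned by their common
     vertices *)
  tri_conforming : forall K K' : 'I_(nelt Th),
    elt K `&` elt K' =
    hull (vertex K) [pred i | [exists i', vertex K i == vertex K' i']] }.

Definition mesh_size Th : R := \big[Num.max/0]_(K < nelt Th) diam (elt K).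

Definition quasi_uniform (kappa : R) Th : Prop :=
  forall K : 'I_(nelt Th),
    mesh_size Th <= kappa * diam (elt K) /\
    exists x rho, [/\ 0 < rho, [set y | enorm (y - x) <= rho] `<=` elt K &
                      diam (elt K) <= kappa * rho].

(* The triple (K, i, K') stands for the face of K opposite to its i-th vertex,
   seen as the face between K and K'. *)
Definition face Th : Type := ('I_(nelt Th) * 'I_d.+1 * 'I_(nelt Th))%type.

Section Face.
Variables (Th : mesh R d) (e : face Th).

Definition fst_elt : 'I_(nelt Th) := e.1.1.
Definition snd_elt : 'I_(nelt Th) := e.2.
Definition face_pt : 'I_d.-1.+1 -> V := face_vertex (vertex fst_elt) e.1.2.
Definition normal : V := outward_normal (vertex fst_elt) e.1.2.
Definition face_diam : R := diam (simplex face_pt).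

(* Requiring fst_elt < snd_elt counts each interior face exactly once, with
   the normal pointing out of the element of smaller label. *)
Definition interior_face Om : bool :=
  [&& (fst_elt < snd_elt)%N,
      [forall j, [exists i', face_pt j == vertex snd_elt i']] &
      `[< open_simplex face_pt `<=` Om >] ].

Definition face_ip (f g : V -> R) : R :=
  surface_int face_pt (fun x => f x * g x).

Definition jump (v : 'I_(nelt Th) -> V -> R) (x : V) : R :=
  v fst_elt x - v snd_elt x.

Definition avg (v : 'I_(nelt Th) -> V -> R) (x : V) : R :=
  (v fst_elt x + v snd_elt x) / 2.

End Face.

(* A piecewise polynomial is given by one polynomial in d variables per
   element; msize p is the total degree of p plus one. *)
Definition broken_poly Th : Type := {ffun 'I_(nelt Th) -> mpoly d R}.

Definition Vh Th (r : nat) (v : broken_poly Th) : Prop :=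
  forall K, (msize (v K) <= r.+1)%N.

Definition peval (p : mpoly d R) (x : V) : R := meval (fun i => x 0 i) p.

Definition pgrad (p : mpoly d R) (x : V) : V := \row_i peval (mderiv i p) x.

End Mesh.

Section Scheme.
Context {R : realType} {d : nat} (Om : set 'rV[R]_d) (Th : mesh R d).
Local Notation V := 'rV[R]_d.
Implicit Types (u v : broken_poly Th) (e : face Th).
Implicit Types (sigma : face Th -> R).

Definition ip u v : R :=
  \sum_K volume_int (elt K) (fun x => peval (u K) x * peval (v K) x).

Definition grad_ip u v : R :=
  \sum_K volume_int (elt K) (fun x => dot (pgrad (u K) x) (pgrad (v K) x)).

Definition pval v (K : 'I_(nelt Th)) (x : V) : R := peval (v K) x.

Definition pdn e v (K : 'I_(nelt Th)) (x : V) : R :=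
  dot (normal e) (pgrad (v K) x).

(* < {d_n u}, [v] > over the interior faces *)
Definition flux_jump u v : R :=
  \sum_(e : face Th | interior_face e Om)
    face_ip e (avg e (pdn e u)) (jump e (pval v)).

Definition jh sigma u v : R :=
  \sum_(e : face Th | interior_face e Om)
    sigma e / face_diam e * face_ip e (jump e (pval u)) (jump e (pval v)).

Definition ah (lambda : R) sigma u v : R :=
  grad_ip u v - flux_jump u v + lambda * flux_jump v u + jh sigma u v.

Definition Phih sigma v : R :=
  2^-1 * grad_ip v v - flux_jump v v + 2^-1 * jh sigma v v.

Definition penalty_above (sigma0 : R) sigma : Prop :=
  forall e, interior_face e Om -> sigma0 < sigma e.

Definition coercivity_constants (r : nat) (sigma0 alpha : R) : Prop :=
  [/\ 0 < sigma0, 0 < alpha &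
      forall sigma, penalty_above sigma0 sigma ->
      forall v, Vh r v -> alpha * (grad_ip v v + jh sigma v v) <= Phih sigma v].

(* nonlin a b is f^{m+1} for u^{m+1} = a and u^m = b *)
Definition nonlin (a b : broken_poly Th) : broken_poly Th :=
  [ffun K => (4^-1 : R) *: (a K ^+ 3 + a K ^+ 2 * b K + a K * b K ^+ 2 + b K ^+ 3)
             - (2^-1 : R) *: (a K + b K)].

(* b = u^m, a = u^{m+1} *)
Definition scheme_step (r : nat) (lambda : R) sigma (eps k : R)
    (b a : broken_poly Th) : Prop :=
  forall v, Vh r v ->
    ip (k^-1 *: (a - b)) v + ah lambda sigma ((2^-1 : R) *: (a + b)) v
    + (eps ^+ 2)^-1 * ip (nonlin a b) v = 0.

End Scheme.

(* Main.v *)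
(* Each time step asks for a zero a of the residual v |-> G(a)(v) on V_h. Since
   (f(a + h) - f(a)) h >= -h^2/2 and a_h(h, h) >= 0 by coercivity,
   (G(a + h) - G(a))(h) >= (1/k - 1/(2 eps^2)) |h|^2, with a positive constant
   exactly when k < 2 eps^2. Uniqueness is immediate. For existence no fixed
   point theorem is needed: in coordinates G is a cubic, hence smooth, map of
   R^n, which is coercive by monotonicity, so |G|^2 attains its minimum; there
   the differential of G is injective, again by monotonicity, and the vanishing
   of the derivative of |G|^2 forces G = 0. *)
Require Import Defs.
From HB Require Import structures.
From mathcomp Require Import all_boot all_order all_algebra.
From mathcomp Require Import all_classical all_reals all_analysis.
From mathcomp Require Import measurable_realfun ring lra.
From mathcomp Require mpoly.
Import Order.TTheory GRing.Theory Num.Theory.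
Import numFieldNormedType.Exports.
Local Open Scope classical_set_scope.
Local Open Scope ring_scope.
Import -(notations) mpoly.

(** * Zeros of strongly monotone maps *)

(** No analytic derivative is ever taken. The residual is cubic in its argument, so along a line it
    expands exactly as a polynomial in [t], and the passage to the limit is reduced to one fact:
    [a <= t * p(t)] for all small positive [t] forces [a <= 0]. That fact gives the injectivity of
    the differential, the conclusion at the minimiser, and the vanishing of the formal partial
    derivatives of a polynomial that is zero on a cube. The main obstacle is that the $L^2$ product
    is definite on [Vh]. Elements of [Vh] are formal polynomials, while the product is a Lebesgue
    integral over simplices for an iterated product measure. A zero integral of [p * p] must first
    force [p] to vanish on a cube inside the simplex, and then to be zero coefficient by
    coefficient. Uniqueness rests on this directly. Existence uses it through compactness of the
    unit sphere, which turns the lower bound in the $L^2$ product into strong monotonicity for the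
    norm of the coordinates. *)

Lemma le0_of_small_poly (R : realType) (p : {poly R}) (a : R) :
  (forall t, 0 < t -> t <= 1 -> a <= t * p.[t]) -> a <= 0.
Proof.
move=> ap; pose b := \sum_(i < size p) `|p`_i|.
have b0 : 0 <= b by apply: sumr_ge0.
have pb t : 0 < t -> t <= 1 -> p.[t] <= b.
  move=> t0 t1; rewrite horner_coef; apply: ler_sum => i _.
  rewrite (le_trans (ler_norm _))// normrM ler_piMr//.
  by rewrite ger0_norm ?exprn_ge0 ?exprn_ile1// ltW.
rewrite leNgt; apply/negP => a0.
have a_le t : 0 < t -> t <= 1 -> a <= t * b.
  by move=> t0 t1; rewrite (le_trans (ap _ t0 t1))// ler_pM2l ?pb.
have b1 : 0 < b + a by rewrite ltr_wpDl.
(* At this [t], which lies in ]0, 1], the bound [a <= t * b] would read [b + a <= b]. *)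
have := a_le (a / (b + a)).
rewrite divr_gt0// ler_pdivrMr// mul1r lerDr b0 => /(_ isT isT).
rewrite mulrAC ler_pdivlMr// ler_pM2l//.
by rewrite gerDl leNgt a0.
Qed.

(** * The Euclidean product compared with the max norm of rows *)

Section Dot.
Context {R : realType} {n : nat}.
Implicit Types x y z : 'rV[R]_n.

Lemma dotC x y : dot x y = dot y x.
Proof. by apply: eq_bigr => i _; rewrite mulrC. Qed.

Lemma dotDl x y z : dot (x + y) z = dot x z + dot y z.
Proof. by rewrite -big_split; apply: eq_bigr => i _; rewrite mxE mulrDl. Qed.

Lemma dotDr x y z : dot z (x + y) = dot z x + dot z y.
Proof. by rewrite dotC dotDl !(dotC _ z). Qed.

Lemma dotZr a x y : dot x (a *: y) = a * dot x y.
Proof. by rewrite dotC dotZl dotC. Qed.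

Lemma dotNl x y : dot (- x) y = - dot x y.
Proof. by rewrite -scaleN1r dotZl mulN1r. Qed.

Lemma dot_ge0 x : 0 <= dot x x.
Proof. by apply: sumr_ge0 => i _; rewrite -expr2 sqr_ge0. Qed.

Lemma dot_eq0 x : dot x x = 0 -> x = 0.
Proof.
move=> xx; apply/rowP => i; rewrite mxE; apply/eqP; rewrite -sqrf_eq0 expr2.
apply/eqP; move: i isT.
by apply: psumr_eq0P xx => k _; rewrite -expr2 sqr_ge0.
Qed.

Lemma coord_le_norm x i : `|x 0 i| <= `|x|.
Proof.
by rewrite /Num.norm/= mx_normrE (le_bigmax _ _ (ord0, i)).
Qed.

(** A crude substitute for Cauchy-Schwarz in the max norm: each of the [n] terms is at most the
    product of the norms. *)
Lemma dot_le_norm x y : dot x y <= n%:R * `|x| * `|y|.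
Proof.
rewrite -mulrA mulr_natl -[X in _ *+ X]card_ord -sumr_const.
apply: ler_sum => i _; rewrite (le_trans (ler_norm _))// normrM.
by rewrite ler_pM ?coord_le_norm.
Qed.

Lemma sqr_norm_le_dot x : `|x| ^+ 2 <= dot x x.
Proof.
suff : `|x| <= Num.sqrt (dot x x).
  by move=> /(lerXn2r 2); rewrite sqr_sqrtr ?dot_ge0//; apply;
    rewrite nnegrE ?sqrtr_ge0.
rewrite {1}/Num.norm/= mx_normrE; apply: bigmax_le; first exact: sqrtr_ge0.
move=> [i j] _ /=; rewrite (ord1 i) -sqrtr_sqr; apply: ler_wsqrtr.
rewrite /dot (bigD1 j)//= -expr2 lerDl.
by apply: sumr_ge0 => k _; rewrite -expr2 sqr_ge0.
Qed.

End Dot.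

Lemma continuous_add (R : realType) (T : topologicalType) (f g : T -> R) :
  continuous f -> continuous g -> continuous (fun x => f x + g x).
Proof. by move=> cf cg x; apply: continuousD; [exact: cf|exact: cg]. Qed.

Lemma continuous_mul (R : realType) (T : topologicalType) (f g : T -> R) :
  continuous f -> continuous g -> continuous (fun x => f x * g x).
Proof. by move=> cf cg x; apply: continuousM; [exact: cf|exact: cg]. Qed.

Lemma continuous_sum (R : realType) (T : topologicalType) (I : Type)
    (s : seq I) (P : pred I) (f : I -> T -> R) :
  (forall i, continuous (f i)) ->
  continuous (fun x => \sum_(i <- s | P i) f i x).
Proof.
move=> cf; elim: s => [|i s IH].
  under [X in continuous X]eq_fun do rewrite big_nil.
  by move=> x; exact: cvg_cst.
under [X in continuous X]eq_fun do rewrite big_cons.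
case: (P i) => // x; apply: continuousD; first exact: cf.
exact: IH.
Qed.

Lemma continuous_prod (R : realType) (T : topologicalType) (I : Type)
    (s : seq I) (P : pred I) (f : I -> T -> R) :
  (forall i, continuous (f i)) ->
  continuous (fun x => \prod_(i <- s | P i) f i x).
Proof.
move=> cf; elim: s => [|i s IH].
  under [X in continuous X]eq_fun do rewrite big_nil.
  by move=> x; exact: cvg_cst.
under [X in continuous X]eq_fun do rewrite big_cons.
case: (P i) => // x; apply: continuousM; first exact: cf.
exact: IH.
Qed.

(* At a minimiser x of |F|^2, J v = - F x has a solution v, along which the
   derivative of |F|^2 is - 2 |F x|^2. *)
Lemma strongly_monotone_zero (R : realType) n (F : 'rV[R]_n -> 'rV[R]_n)
    (c : R) :
  0 < c -> (forall i, continuous (fun x => F x 0 i)) ->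
  (forall x v : 'rV[R]_n, c * `|v| ^+ 2 <= dot (F (x + v) - F x) v) ->
  (forall x : 'rV[R]_n, exists J : 'M[R]_n, forall v : 'rV[R]_n,
    exists C D : 'rV[R]_n, forall t,
    F (x + t *: v) = F x + t *: (v *m J) + t ^+ 2 *: C + t ^+ 3 *: D) ->
  exists x, F x = 0.
Proof.
move=> c0 cF mF dF; pose phi x := dot (F x) (F x).
have cphi : continuous phi.
  by apply: continuous_sum => i x; apply: continuousM; exact: cF.
(* Monotonicity between 0 and [x], with [dot_le_norm], gives [c |x| <= n (|F x| + |F 0|)]. Hence
   [phi x <= phi 0], which bounds [|F x|] by the square root of [phi 0], confines [x] to the ball of
   radius [rho]. *)
pose rho := n%:R * (Num.sqrt (phi 0) + `|F 0|) / c.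
have rho0 : 0 <= rho.
  by rewrite divr_ge0 ?mulr_ge0 ?addr_ge0 ?sqrtr_ge0// ltW.
have phi_gt x : rho < `|x| -> phi 0 < phi x.
  apply: contraTT; rewrite -!leNgt => phix.
  have Fx : `|F x| <= Num.sqrt (phi 0).
    rewrite -[leLHS]ger0_norm// -sqrtr_sqr ler_wsqrtr//.
    exact: le_trans (sqr_norm_le_dot _) phix.
  have [->|x0] := eqVneq x 0; first by rewrite normr0.
  have := mF 0 x; rewrite add0r => /le_trans/(_ (dot_le_norm _ _)).
  rewrite expr2 mulrA ler_pM2r ?normr_gt0// => cx.
  rewrite ler_pdivlMr// mulrC (le_trans cx)// ler_wpM2l//.
  by rewrite (le_trans (ler_normB _ _))// lerD.
pose B := [set x : 'rV[R]_n | `|x| <= rho].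
have [||x Bx minx] := @EVT_min_rV R n phi B _ _ (continuous_subspaceT cphi).
- by exists 0; rewrite /B/= normr0.
- apply: bounded_closed_compact.
    exists rho; split; [exact: num_real|move=> M rM x Bx].
    exact: le_trans Bx (ltW rM).
  rewrite /B (_ : mkset _ =
    (fun x : 'rV[R]_n => `|x|) @^-1` [set y | y <= rho])//.
  apply: preimage_closed; last exact: closed_le.
  by move=> x _; exact: norm_continuous.
have min_phi y : phi x <= phi y.
  have [yB|yB] := leP `|y| rho; first by apply: minx; rewrite inE.
  apply: le_trans (ltW (phi_gt _ yB)); apply: minx.
  by rewrite inE /B/= normr0.
have [J dFx] := dF x.
have Jinj (v : 'rV[R]_n) : v *m J = 0 -> v = 0.
  move=> vJ; have [C [D FE]] := dFx v.
  apply/eqP; rewrite -normr_eq0 -sqrf_eq0 eq_le sqr_ge0 andbT.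
  rewrite -(pmulr_rle0 _ c0).
  (* With the linear term gone, monotonicity along [t *: v] has order $t^2$ on the left and $t^3$ on
     the right; both sides are divided by $t^2$. *)
  apply: (@le0_of_small_poly _ (Poly [:: dot C v; dot D v])) => t t0 t1.
  have xK (y z : 'rV[R]_n) : y + z - y = z by rewrite addrC addKr.
  have := mF x (t *: v); rewrite normrZ exprMn FE vJ scaler0 addr0.
  rewrite -(addrA (F x)) xK dotZr dotDl !dotZl.
  rewrite (gtr0_norm t0) horner_Poly/= mul0r add0r mulrCA => h.
  by rewrite -(ler_pM2l (exprn_gt0 2 t0)); lra.
exists x; apply: dot_eq0; apply/eqP; rewrite eq_le dot_ge0 andbT.
have Ju : J \in unitmx.
  by rewrite -row_free_unit; apply/inj_row_free => v; exact: Jinj.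
have [C [D FE]] := dFx (- (F x *m invmx J)).
rewrite mulNmx mulmxKV// in FE.
rewrite -(@pmulr_rle0 _ 2)//.
(* In this direction [F] becomes $(1-t) f + t^2 C + t^3 D$. The polynomial below is $(|(1-t) f + t^2
   C + t^3 D|^2 - |f|^2 + 2 t |f|^2) / t^2$, so minimality of [x] is the required inequality after
   division by [t]. *)
pose f := F x; pose d (u v : 'rV[R]_n) := dot u v.
apply: (@le0_of_small_poly _ (Poly [:: d f f + 2 * d f C;
  2 * d f D - 2 * d f C; d C C - 2 * d f D; 2 * d C D; d D D])) => t t0 t1.
have := min_phi (x + t *: - (F x *m invmx J)).
rewrite /phi FE !dotDl !dotDr !dotZl !dotZr !dotNl.
rewrite !(dotC _ (- _)) !dotNl (dotC C (F x)) (dotC D (F x)) (dotC D C) => h.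
by rewrite horner_Poly/= /d /f mul0r add0r -(ler_pM2l t0); lra.
Qed.

(** * Bounded measurable functions of tuples *)

Section BoundedMeasurable.
Context {R : realType} {m : nat}.
Local Notation T := (m.-tuple (measurableTypeR R)).
Implicit Types (A : set T) (f g : T -> R) (c : 'I_m -> R).

Definition box c (a : R) : set T :=
  [set t | forall i, `|(tnth t i : R) - c i| <= a].

(** This class is stable under sums and products, so it contains the polynomials in bounded
    measurable coordinates, and on a set of finite measure its members are integrable, as linearity
    of the integral demands. *)
Definition bounded_measurable A f : Prop :=
  measurable_fun A f /\ exists B, forall t, A t -> `|f t| <= B.

Lemma measurable_forall (n : nat) (A : 'I_n -> set T) :
  (forall i, measurable (A i)) -> measurable [set t | forall i, A i t].
Proof.
move=> mA; rewrite (_ : mkset _ = \bigcap_(i in [set: 'I_n]) A i).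
  exact: fin_bigcap_measurable.
by apply/seteqP; split => [t At i _|t At i]; exact: At.
Qed.

Lemma measurable_le f g : measurable_fun setT f -> measurable_fun setT g ->
  measurable [set t | f t <= g t].
Proof.
move=> mf mg; rewrite -[X in measurable X]setTI.
exact: measurable_fun_le.
Qed.

Lemma measurable_coord i : measurable_fun [set: T] (fun t => tnth t i : R).
Proof. exact: measurable_tnth. Qed.

Lemma measurable_box c a : measurable (box c a).
Proof.
apply: measurable_forall => i; apply: measurable_le => //.
apply: measurableT_comp => //; apply: measurable_funB => //.
exact: measurable_coord.
Qed.

Section Closure.
Variable A : set T.
Hypothesis mA : measurable A.

Lemma bm_cst (r : R) : bounded_measurable A (fun=> r).
Proof. by split; [exact: measurable_cst|exists `|r|]. Qed.

Lemma bmD f g : bounded_measurable A f -> bounded_measurable A g ->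
  bounded_measurable A (fun t => f t + g t).
Proof.
move=> [mf [B fB]] [mg [C gC]]; split; first exact: measurable_funD.
exists (B + C) => t At; rewrite (le_trans (ler_normD _ _))// lerD//.
  exact: fB.
exact: gC.
Qed.

Lemma bmM f g : bounded_measurable A f -> bounded_measurable A g ->
  bounded_measurable A (fun t => f t * g t).
Proof.
move=> [mf [B fB]] [mg [C gC]]; split; first exact: measurable_funM.
by exists (B * C) => t At; rewrite normrM ler_pM// ?fB ?gC.
Qed.

Lemma bm_sum (I : Type) (s : seq I) (P : pred I) (F : I -> T -> R) :
  (forall i, bounded_measurable A (F i)) ->
  bounded_measurable A (fun t => \sum_(i <- s | P i) F i t).
Proof.
move=> bF; elim: s => [|i s IH].
  by under eq_fun do rewrite big_nil; exact: bm_cst.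
under eq_fun do rewrite big_cons.
by case: (P i) => //; exact: bmD.
Qed.

Lemma bm_prod (I : Type) (s : seq I) (P : pred I) (F : I -> T -> R) :
  (forall i, bounded_measurable A (F i)) ->
  bounded_measurable A (fun t => \prod_(i <- s | P i) F i t).
Proof.
move=> bF; elim: s => [|i s IH].
  by under eq_fun do rewrite big_nil; exact: bm_cst.
under eq_fun do rewrite big_cons.
by case: (P i) => //; exact: bmM.
Qed.

Lemma bmX f n : bounded_measurable A f ->
  bounded_measurable A (fun t => f t ^+ n).
Proof.
move=> bf; elim: n => [|n IH]; first exact: bm_cst.
by under eq_fun do rewrite exprS; exact: bmM.
Qed.

End Closure.

End BoundedMeasurable.

(** This value serves twice: bounded sets have finite measure, and a box of positive side has
    positive measure. *)
Lemma lebesgue_tuple_box (R : realType) m (c : 'I_m -> R) (a : R) : 0 <= a ->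
  lebesgue_tuple m (box c a) = ((2 * a) ^+ m)%:E.
Proof.
move=> a0; elim: m c => [|m IH] c.
  (* In dimension 0 the measure is the point mass at the empty tuple, which lies in every box. *)
  by rewrite /= diracE mem_set//= => -[].
rewrite /= /lebesgue_step /pushforward.
rewrite (_ : _ @^-1` _ = `[c ord0 - a, c ord0 + a]%classic `*`
    box (fun i => c (lift ord0 i)) a).
  rewrite product_measure1E//; last exact: measurable_box.
  rewrite exprS EFinM; apply: (congr2 mule _ (IH _)).
  transitivity (@lebesgue_measure R `[c ord0 - a, c ord0 + a]%classic) => //.
  rewrite lebesgue_measure_itv/= lte_fin.
  by have [lt|lt] := ltP (c ord0 - a) (c ord0 + a); congr EFin; lra.
apply/seteqP; split => -[x t] /=.
  move=> h; split.
    by have := h ord0; rewrite in_itv/= ler_distl.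
  by move=> i; have := h (lift ord0 i); rewrite tnthS.
rewrite in_itv/= => -[xc h] i; have [j ->|->] := unliftP ord0 i.
  by rewrite tnthS; exact: h.
by rewrite ler_distl.
Qed.

Section Integral.
Context {R : realType} {m : nat}.
Local Notation T := (m.-tuple (measurableTypeR R)).
Local Notation mu := (@lebesgue_tuple R m).
Variable A : set T.
Hypotheses (mA : measurable A) (Aoo : (mu A < +oo)%E).
Implicit Types f g : T -> R.

Lemma bm_integrable f : bounded_measurable A f -> mu.-integrable A (EFin \o f).
Proof.
move=> [mf [B fB]]; apply: measurable_bounded_integrable => //.
exists B; split; [exact: num_real|move=> C BC t /fB/le_trans; apply].
exact: ltW.
Qed.

Lemma bm_RintegralD f g : bounded_measurable A f -> bounded_measurable A g ->
  \int[mu]_(t in A) (f t + g t) = \int[mu]_(t in A) f t + \int[mu]_(t in A) g t.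
Proof. by move=> bf bg; rewrite RintegralD//; exact: bm_integrable. Qed.

Lemma bm_RintegralZ r f : bounded_measurable A f ->
  \int[mu]_(t in A) (r * f t) = r * \int[mu]_(t in A) f t.
Proof. by move=> bf; rewrite RintegralZl//; exact: bm_integrable. Qed.

End Integral.

Lemma lebesgue_tuple_fin (R : realType) m
    (A : set (m.-tuple (measurableTypeR R))) c a : measurable A -> A `<=` box c a -> (lebesgue_tuple m A < +oo)%E.
Proof.
(* The sign of [a] is unknown, whereas [lebesgue_tuple_box] wants a nonnegative half-side. *)
move=> mA Ac; apply: (@le_lt_trans _ _ (lebesgue_tuple m (box c `|a|))).
  apply: le_measure; rewrite ?inE//; first exact: measurable_box.
  by move=> t /Ac h i; rewrite (le_trans (h i))// ler_norm.
by rewrite lebesgue_tuple_box// ltry.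
Qed.

Lemma measurable_unit_simplex (R : realType) m : measurable (@unit_simplex R m).
Proof.
apply: measurableI; last first.
  apply: measurable_le => //; apply: measurable_sum => i.
  exact: measurable_coord.
apply: measurable_forall => i; apply: measurable_le => //.
exact: measurable_coord.
Qed.

Lemma unit_simplex_box (R : realType) m :
  @unit_simplex R m `<=` box (fun=> 0) 1.
Proof.
move=> t [t0 t1] i; rewrite subr0 ger0_norm// (le_trans _ t1)//.
by rewrite (bigD1 i)//= lerDl; apply: sumr_ge0 => j _; exact: t0.
Qed.

(** * Polynomial functions *)

Section PolynomialFunctions.
Context {R : realType} {d : nat}.
Local Notation V := 'rV[R]_d.
Implicit Types (p q : mpoly d R) (x : V).

Lemma pevalD p q x : peval (p + q) x = peval p x + peval q x.
Proof. exact: mevalD. Qed.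

Lemma pevalZ (c : R) p x : peval (c *: p) x = c * peval p x.
Proof. exact: mevalZ. Qed.

Lemma pevalN p x : peval (- p) x = - peval p x.
Proof. exact: mevalN. Qed.

Lemma pevalM p q x : peval (p * q) x = peval p x * peval q x.
Proof. exact: mevalM. Qed.

Lemma continuous_peval p : continuous (peval p : V -> R).
Proof.
have -> : peval p = (fun x =>
    \sum_(m <- msupp p) mcoeff m p * \prod_i x 0 i ^+ m i).
  by apply/funext => x; exact: mevalE.
apply: continuous_sum => m; apply: continuous_mul; first exact: cst_continuous.
apply: continuous_prod => i; elim: (m i) => [|k IH].
  exact: cst_continuous.
under eq_fun do rewrite exprS.
by apply: continuous_mul => //; exact: coord_continuous.
Qed.

Lemma bm_peval m (A : set (m.-tuple (measurableTypeR R)))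
    (g : m.-tuple (measurableTypeR R) -> V) p : measurable A ->
  (forall i, bounded_measurable A (fun t => g t 0 i)) ->
  bounded_measurable A (fun t => peval p (g t)).
Proof.
move=> mA bg; under eq_fun do rewrite /peval mevalE.
apply: bm_sum => // n; apply: bmM => //; first exact: bm_cst.
by apply: bm_prod => // i; exact: bmX.
Qed.

(** A Taylor expansion along a coordinate axis with polynomial remainder. It ties the formal
    derivative [mderiv] to the values of [p], and it passes from constants and variables to sums and
    products. *)
Definition shift_expands p := forall x i, exists q : {poly R}, forall s,
  peval p (x + s *: delta_mx 0 i) =
  peval p x + s * peval (mderiv i p) x + s ^+ 2 * q.[s].

Lemma shift_expandsD p q :
  shift_expands p -> shift_expands q -> shift_expands (p + q).
Proof.
move=> hp hq x i; have [a pa] := hp x i; have [b qb] := hq x i.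
by exists (a + b) => s; rewrite mderivD !pevalD pa qb hornerD; ring.
Qed.

Lemma shift_expandsC (c : R) : shift_expands (mpolyC d c).
Proof.
move=> x i; exists 0 => s; rewrite mderivC -(mpolyC0 d) /peval !mevalC horner0.
by rewrite !mulr0 !addr0.
Qed.

Lemma shift_expandsM p q :
  shift_expands p -> shift_expands q -> shift_expands (p * q).
Proof.
move=> hp hq x i; have [a pa] := hp x i; have [b qb] := hq x i.
pose p' := peval (mderiv i p) x; pose q' := peval (mderiv i q) x.
exists ((p' * q')%:P + (peval p x)%:P * b + (peval q x)%:P * a +
  'X * (p'%:P * b + q'%:P * a) + 'X^2 * a * b) => s.
by rewrite mderivM pevalD !pevalM pa qb !hornerE/= -/p' -/q'; ring.
Qed.

Lemma shift_expandsX i : shift_expands (mpolyX R (mnm1 i)).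
Proof.
move=> x j; exists 0 => s.
rewrite horner0 mulr0 addr0 /peval !mevalXU mderivX mevalZ mevalX !mxE/=.
rewrite mnm1E eq_sym; congr (_ + s * _).
have [->|_] := eqVneq i j; last by rewrite mul0r.
rewrite mul1r big1// => k _.
by rewrite mnmBE subnn.
Qed.

Lemma shift_expands_all p : shift_expands p.
Proof.
elim/mpolyind : p => [|c m p _ _ IH].
  by rewrite -(mpolyC0 d); exact: shift_expandsC.
apply: shift_expandsD => //; rewrite -mul_mpolyC.
apply: shift_expandsM; first exact: shift_expandsC.
rewrite mpolyXE_id; elim/big_rec : _ => [|i q _ hq].
  by rewrite -(mpolyC1 d); exact: shift_expandsC.
apply: shift_expandsM => //; elim: (m i) => [|k IHk].
  by rewrite expr0 -(mpolyC1 d); exact: shift_expandsC.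
by rewrite exprS; apply: shift_expandsM => //; exact: shift_expandsX.
Qed.

Lemma mderiv_vanishes (x0 : V) (a : R) p i :
  (forall x, (forall j, `|x 0 j - x0 0 j| < a) -> peval p x = 0) ->
  forall x, (forall j, `|x 0 j - x0 0 j| < a) -> peval (mderiv i p) x = 0.
Proof.
move=> p0 x xa; have [q pq] := shift_expands_all p x i.
set D := peval (mderiv i p) x in pq *.
(* Half the distance from [x] to the boundary of the cube along axis [i]: moving by [t * g] with
   [t <= 1] stays inside. *)
pose g := (a - `|x 0 i - x0 0 i|) / 2.
have g0 : 0 < g by have := xa i; rewrite -subr_gt0 => h; rewrite divr_gt0.
have gE : 2 * g = a - `|x 0 i - x0 0 i| by rewrite mulrC divfK.
clearbody g.
(* [le0_of_small_poly] is one-sided, so it is applied to $D^2$. The expansion reads $D = - t g\, q(t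
   g)$, hence $D^2 = t \cdot (- g D\, q(g t))$. *)
apply/eqP; rewrite -sqrf_eq0 eq_le sqr_ge0 andbT.
apply: (@le0_of_small_poly _ ((- g * D)%:P * (q \Po (g *: 'X)))) => t t0 t1.
have := pq (t * g); rewrite p0; last first.
  move=> j; rewrite !mxE/=; have [->|_] := eqVneq j i; last first.
    by rewrite mulr0 addr0; exact: xa.
  rewrite mulr1 addrAC (le_lt_trans (ler_normD _ _))//.
  rewrite (gtr0_norm (mulr_gt0 t0 g0)).
  have : t * g <= g by rewrite ler_piMl// ltW.
  by lra.
rewrite p0// add0r !hornerE horner_comp !hornerE/= => h.
have {h} : t * g * (D + t * g * q.[g * t]) = 0.
  by rewrite [RHS]h (mulrC g t); ring.
move/eqP; rewrite mulf_eq0 mulf_eq0 (gt_eqF t0) (gt_eqF g0)/=.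
rewrite addr_eq0 => /eqP DE.
by rewrite expr2 {1}DE le_eqVlt; apply/orP; left; apply/eqP; ring.
Qed.

(** Induction on a strict bound [n] of the degree. The partial derivatives vanish on the same cube,
    so they are zero; in characteristic 0 this kills every coefficient but the constant one, which
    is the value at the centre. *)
Lemma mpoly_vanishes_eq0 (x0 : V) (a : R) p : 0 < a ->
  (forall x, (forall j, `|x 0 j - x0 0 j| < a) -> peval p x = 0) -> p = 0.
Proof.
move=> a0; have := @msize_mdeg_ge d R p.
move: (mmeasure _ p) => n hn.
have {hn} : forall m, (n <= mdeg m)%N -> mcoeff m p = 0.
  by move=> m nm; apply/eqP; apply: contraNT (hn _ nm); rewrite mcoeff_msupp.
elim: n p => [|n IH] p pn p0.
  by apply/mpolyP => m; rewrite mcoeff0 pn.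
have dp i : mderiv i p = 0.
  apply: IH; last exact: mderiv_vanishes.
  by move=> m nm; rewrite mcoeff_mderiv pn ?mul0rn// mdegD mdeg1 addn1.
have pE : p = mpolyC d (mcoeff mnm0 p).
  apply/mpolyP => m; rewrite mcoeffC.
  have [->|m0] := eqVneq; first by rewrite mulr1.
  rewrite mulr0.
  move: m0; rewrite -mdeg_eq0 mdegE sum_nat_eq0 negb_forall => /existsP[i mi].
  have := congr1 (mcoeff (mnm_sub m (mnm1 i))) (dp i).
  rewrite mcoeff_mderiv mcoeff0 submK ?lep1mP// => /eqP.
  by rewrite mulrn_eq0 => /orP[//|/eqP].
have := p0 x0; rewrite pE /peval mevalC => -> //.
by move=> j; rewrite subrr normr0.
Qed.

End PolynomialFunctions.

(** * Integrals over simplices *)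

Section SurfaceIntegral.
Context {R : realType} {d m : nat} (w : 'I_m.+1 -> 'rV[R]_d).

Lemma surface_int_linear (c : R) (p q : mpoly d R) :
  surface_int w (peval (c *: p + q)) =
  c * surface_int w (peval p) + surface_int w (peval q).
Proof.
pose g (t : m.-tuple (measurableTypeR R)) :=
  w ord0 + \sum_j (tnth t j : R) *: (w (lift ord0 j) - w ord0).
have mS := measurable_unit_simplex R m.
have bmg i : bounded_measurable (@unit_simplex R m) (fun t => g t 0 i).
  under eq_fun do rewrite mxE summxE.
  apply: bmD => //; first exact: bm_cst.
  apply: bm_sum => // j; under eq_fun do rewrite mxE.
  apply: bmM => //; last exact: bm_cst.
  split; first exact: measurable_funS (measurable_coord j).
  by exists 1 => t /unit_simplex_box/(_ j); rewrite subr0.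
have bmp r : bounded_measurable (@unit_simplex R m) (fun t => peval r (g t)).
  exact: bm_peval.
have fin := lebesgue_tuple_fin _ _ _ _ _ mS (unit_simplex_box R m).
rewrite /surface_int mulrCA -mulrDr; congr (_ * _).
rewrite -bm_RintegralZ// -bm_RintegralD//; last first.
  by apply: bmM => //; exact: bm_cst.
by apply: eq_Rintegral => t _; rewrite pevalD pevalZ.
Qed.

Lemma surface_int_ge0 (f : 'rV[R]_d -> R) :
  (forall x, 0 <= f x) -> 0 <= surface_int w f.
Proof.
by move=> f0; rewrite mulr_ge0 ?sqrtr_ge0//; apply: Rintegral_ge0 => t _.
Qed.

End SurfaceIntegral.

(** * Volume integrals over a nondegenerate simplex *)

Section Simplex.
Context {R : realType} {d : nat} (w : 'I_d.+1 -> 'rV[R]_d).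
Hypothesis wfree : affinely_independent w.
Local Notation T := (d.-tuple (measurableTypeR R)).

(** The barycentric coordinates of [x] at the vertices other than [w ord0]; the one at [w ord0] is 1
    minus their sum. *)
Definition bary (x : 'rV[R]_d) : 'rV[R]_d :=
  (x - w ord0) *m invmx (edge_mx w).

Lemma affine_comb (t : 'I_d.+1 -> R) : \sum_i t i = 1 ->
  \sum_i t i *: w i = w ord0 + (\row_j t (lift ord0 j)) *m edge_mx w.
Proof.
rewrite !big_ord_recl => t1.
rewrite mulmx_sum_row (_ : t ord0 = 1 - \sum_i t (lift ord0 i)); last first.
  by rewrite -t1 addrK.
rewrite scalerBl scale1r -addrA scaler_suml addrC -sumrN -big_split addrC/=.
congr (_ + _); apply: eq_bigr => i _.
by rewrite mxE rowK scalerBr addrC.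
Qed.

(** The existential description becomes [d + 1] affine inequalities, from which measurability and an
    inner box follow. *)
Lemma simplexE : simplex w =
  [set x | (forall j, 0 <= bary x 0 j) /\ \sum_j bary x 0 j <= 1].
Proof.
have Eu : edge_mx w \in unitmx by rewrite -row_free_unit.
apply/seteqP; split => [x [t [t0 _ t1] xE]|x [x0 x1]] /=.
  have bE j : bary x 0 j = t (lift ord0 j).
    by rewrite /bary xE affine_comb// addrC addKr mulmxK// mxE.
  split=> [j|]; first by rewrite bE.
  under eq_bigr do rewrite bE.
  by rewrite -t1 big_ord_recl lerDr.
pose t (i : 'I_d.+1) := if unlift ord0 i is Some j then bary x 0 j
  else 1 - \sum_j bary x 0 j.
have tS j : t (lift ord0 j) = bary x 0 j by rewrite /t liftK.
have t1 : \sum_i t i = 1.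
  by rewrite big_ord_recl (eq_bigr _ (fun j _ => tS j)) /t unlift_none subrK.
exists t.
  split=> // i; rewrite /t; case: (unlift ord0 i) => [j|]; first exact: x0.
  by rewrite subr_ge0.
rewrite affine_comb// (_ : \row_j _ = bary x).
  by rewrite mulmxKV// addrC subrK.
by apply/rowP => j; rewrite mxE tS.
Qed.

Definition simplex_tuples : set T := [set t | simplex w (row_of_tuple t)].

Lemma measurable_bary j :
  measurable_fun [set: T] (fun t => bary (row_of_tuple t) 0 j).
Proof.
under eq_fun do rewrite mxE.
apply: measurable_sum => k; under eq_fun do rewrite !mxE.
apply: measurable_funM => //; apply: measurable_funD => //.
exact: measurable_coord.
Qed.

Lemma measurable_simplex : measurable simplex_tuples.
Proof.
rewrite /simplex_tuples simplexE; apply: measurableI.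
  apply: measurable_forall => j; apply: measurable_le => //.
  exact: measurable_bary.
apply: measurable_le => //; apply: measurable_sum => j.
exact: measurable_bary.
Qed.

Lemma simplex_box : simplex_tuples `<=` box (fun=> 0) (\sum_i `|w i|).
Proof.
move=> t [s [s0 _ s1] tE] j; rewrite subr0.
have -> : (tnth t j : R) = row_of_tuple t 0 j by rewrite mxE.
rewrite tE summxE (le_trans (ler_norm_sum _ _ _))//; apply: ler_sum => i _.
have si1 : s i <= 1.
  by rewrite -s1 (bigD1 i)//= lerDl; apply: sumr_ge0 => k _; exact: s0.
rewrite mxE normrM (ger0_norm (s0 i)).
by rewrite (le_trans (ler_piMl _ si1))// coord_le_norm.
Qed.

(** At the barycentre [x0] all barycentric coordinates equal [c], the inverse of [d + 1]. Within
    distance [a] they change by at most [c] in total, so each stays nonnegative and the [d] of them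
    sum to at most [d c + c = 1]. *)
Lemma simplex_contains_box : exists x0 : 'rV[R]_d, exists2 a, 0 < a &
  forall x : 'rV[R]_d, (forall j, `|x 0 j - x0 0 j| <= a) -> simplex w x.
Proof.
have Eu : edge_mx w \in unitmx by rewrite -row_free_unit.
pose c : R := (d.+1)%:R^-1.
have c0 : 0 < c by rewrite invr_gt0.
pose x0 := w ord0 + const_mx c *m edge_mx w.
pose S := \sum_j \sum_k `|invmx (edge_mx w) k j|.
have S0 : 0 <= S by apply: sumr_ge0 => j _; apply: sumr_ge0.
have S1 : 0 < S + 1 by rewrite ltr_wpDl.
(* [S] bounds the total change of [bary] per unit of displacement; adding 1 keeps the denominator
   positive. *)
pose a := c / (S + 1); have a0 : 0 < a by rewrite divr_gt0.
have aS : a * S <= c by rewrite mulrAC ler_pdivrMr// ler_pM2l// lerDl.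
exists x0, a => // x xa.
pose e j := bary x 0 j - c.
have eE j : e j = \sum_k (x 0 k - x0 0 k) * invmx (edge_mx w) k j.
  have bx0 : bary x0 0 j = c by rewrite /bary addrC addKr mulmxK// mxE.
  rewrite /e -bx0 !mxE -sumrB; apply: eq_bigr => k _.
  by rewrite !mxE -mulrBl; congr (_ * _); ring.
have e_le j : `|e j| <= a * \sum_k `|invmx (edge_mx w) k j|.
  rewrite eE mulr_sumr (le_trans (ler_norm_sum _ _ _))//.
  by apply: ler_sum => k _; rewrite normrM ler_wpM2r.
have se_le : \sum_j `|e j| <= c.
  rewrite (le_trans _ aS)// /S mulr_sumr; apply: ler_sum => j _; exact: e_le.
have bE j : bary x 0 j = c + e j by rewrite /e addrC subrK.
rewrite simplexE; split=> [j|].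
  rewrite bE -lerBlDl sub0r lerNl (le_trans _ se_le)//.
  rewrite (bigD1 j)//= (le_trans (ler_norm _))// normrN lerDl.
  exact: sumr_ge0.
under eq_bigr do rewrite bE.
rewrite big_split/= sumr_const card_ord -mulr_natl.
have : d%:R * c = 1 - c.
  by rewrite -[X in X - _](@mulfV _ d.+1%:R)// -/c -natr1 mulrDl mul1r addrK.
move=> ->; have : \sum_j e j <= c.
  by rewrite (le_trans _ se_le)//; apply: ler_sum => j _; exact: ler_norm.
by lra.
Qed.

Lemma bm_volume (p : mpoly d R) :
  bounded_measurable simplex_tuples (fun t => peval p (row_of_tuple t)).
Proof.
apply: bm_peval; first exact: measurable_simplex.
move=> i; under eq_fun do rewrite mxE; split.
  exact: measurable_funS (measurable_coord i).
by exists (\sum_i `|w i|) => t /simplex_box/(_ i); rewrite subr0.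
Qed.

Lemma simplex_fin : (lebesgue_tuple d simplex_tuples < +oo)%E.
Proof. exact: lebesgue_tuple_fin _ _ _ _ _ measurable_simplex simplex_box. Qed.

Lemma volume_int_linear (c : R) (p q : mpoly d R) :
  volume_int (simplex w) (peval (c *: p + q)) =
  c * volume_int (simplex w) (peval p) + volume_int (simplex w) (peval q).
Proof.
have mS := measurable_simplex; have bmS := bm_volume; have fin := simplex_fin.
rewrite /volume_int -/simplex_tuples -bm_RintegralZ//.
rewrite -bm_RintegralD//; last first.
  by apply: bmM => //; exact: bm_cst.
by apply: eq_Rintegral => t _; rewrite pevalD pevalZ.
Qed.

Lemma volume_int_ge0 (f : 'rV[R]_d -> R) :
  (forall x, 0 <= f x) -> 0 <= volume_int (simplex w) f.
Proof. by move=> f0; apply: Rintegral_ge0. Qed.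

(** If [p] were nonzero at some [y] near the centre of the inner box, continuity would keep [p * p]
    above a positive constant on a small box around [y], and the integral would be positive. *)
Lemma volume_int_sqr_eq0 (p : mpoly d R) :
  volume_int (simplex w) (peval (p * p)) = 0 -> p = 0.
Proof.
move=> pp0; have [x0 [a a0 x0a]] := simplex_contains_box.
(* Half of [a] leaves room for a box of half-side at most [a / 2] around [y] inside the simplex. *)
apply: (@mpoly_vanishes_eq0 _ _ x0 (a / 2)); first by rewrite divr_gt0.
move=> y ya; apply/eqP; apply/negPn/negP => py.
have py0 : 0 < `|peval p y| / 2 by rewrite divr_gt0// normr_gt0.
have [r r0 yr] : exists2 r : R, 0 < r &
    forall x : 'rV[R]_d, (forall j, `|x 0 j - y 0 j| <= r) ->
    (`|peval p y| / 2) ^+ 2 <= peval (p * p) x /\ simplex w x.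
  have /cvgrPdist_lt/(_ _ py0) := continuous_peval p y.
  rewrite -nbhs_ballE => -[e /= e0 eE].
  exists (Num.min (e / 2) (a / 2)); first by rewrite lt_min !divr_gt0.
  move=> x xy; split; last first.
    apply: x0a => j; have := xy j; rewrite le_min => /andP[_ xyj].
    have := ya j; have := ler_distD (y 0 j) (x 0 j) (x0 0 j).
    by lra.
  have /eE/= : ball y e x.
    split=> // i j; rewrite (ord1 i) /ball/= distrC.
    by have := xy j; rewrite le_min => /andP[xyj _]; lra.
  have := ler_dist_dist (peval p y) (peval p x).
  rewrite pevalM -expr2 -(ger0_norm (sqr_ge0 (peval p x))) normrX => h1 h2.
  rewrite lerXn2r ?nnegrE// ?(ltW py0)//.
  have := ler_normD (peval p y - peval p x) (peval p x).
  by rewrite subrK; lra.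
pose B : set T := box (fun j => y 0 j) r.
pose F (t : T) := (peval (p * p) (row_of_tuple t))%:E.
have BP t : B t -> (`|peval p y| / 2) ^+ 2 <= peval (p * p) (row_of_tuple t) /\
    simplex_tuples t.
  by move=> Bt; apply: yr => j; rewrite mxE; exact: Bt.
have [mF _] := bm_volume (p * p).
(* The real-valued integral is also 0 when the extended one is infinite, so integrability is needed
   to transfer [pp0]. *)
have int0 : (\int[lebesgue_tuple d]_(t in simplex_tuples) F t = 0)%E.
  rewrite -[LHS]fineK.
    by congr EFin; exact: pp0.
  apply: integrable_fin_num; first exact: measurable_simplex.
  apply: bm_integrable; [exact: measurable_simplex|exact: simplex_fin|].
  exact: bm_volume.
have : (\int[lebesgue_tuple d]_(t in B) F t <= 0)%E.
  rewrite -int0; apply: ge0_subset_integral.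
  - exact: measurable_box.
  - exact: measurable_simplex.
  - exact/measurable_EFinP.
  - by move=> t _; rewrite lee_fin pevalM -expr2 sqr_ge0.
  - by move=> t /BP[].
apply/negP; rewrite -ltNge.
apply: (@lt_le_trans _ _
  (\int[lebesgue_tuple d]_(t in B) ((`|peval p y| / 2) ^+ 2)%:E)%E); last first.
  apply: ge0_le_integral.
  - exact: measurable_box.
  - by move=> t _; rewrite lee_fin sqr_ge0.
  - exact: measurable_cst.
  - apply: (measurable_funS _ _ (_ : measurable_fun simplex_tuples _)).
    + exact: measurable_simplex.
    + by move=> t /BP[].
    + exact/measurable_EFinP.
  - by move=> t /BP[+ _]; rewrite lee_fin.
rewrite integral_cst; last exact: measurable_box.
suff : (0 < ((`|peval p y| / 2) ^+ 2)%:E * ((2 * r) ^+ d)%:E)%E.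
  by rewrite -(lebesgue_tuple_box _ _ (fun j => y 0 j) _ (ltW r0)).
rewrite -EFinM lte_fin; apply: mulr_gt0; apply: exprn_gt0 => //.
by rewrite mulr_gt0.
Qed.

End Simplex.

(** * The bilinear forms of the scheme *)

Section Forms.
Context {R : realType} {U W : lmodType R}.
Implicit Types L : U -> R.

Definition is_linear_form L :=
  forall (c : R) u v, L (c *: u + v) = c * L u + L v.

Definition is_bilinear_form (B : U -> W -> R) :=
  (forall v, is_linear_form (B ^~ v)) /\
  (forall u (c : R) v v', B u (c *: v + v') = c * B u v + B u v').

Lemma linear_form0 L : is_linear_form L -> L 0 = 0.
Proof.
move=> hL; have := hL (-1) 0 0.
by rewrite scaler0 addr0 mulN1r addNr.
Qed.

Lemma linear_formD L u v : is_linear_form L -> L (u + v) = L u + L v.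
Proof. by move=> hL; have := hL 1 u v; rewrite scale1r mul1r. Qed.

Lemma linear_formZ L (c : R) u : is_linear_form L -> L (c *: u) = c * L u.
Proof. by move=> hL; have := hL c u 0; rewrite addr0 linear_form0// addr0. Qed.

Lemma linear_form_sum L (I : Type) (s : seq I) (P : pred I) (F : I -> U) :
  is_linear_form L ->
  L (\sum_(i <- s | P i) F i) = \sum_(i <- s | P i) L (F i).
Proof.
move=> hL; apply: (big_morph L) => [u v|]; first exact: linear_formD.
exact: linear_form0.
Qed.

Lemma add_linear_form L L' : is_linear_form L -> is_linear_form L' ->
  is_linear_form (fun u => L u + L' u).
Proof. by move=> hL hL' c u v; rewrite hL hL'; ring. Qed.

Lemma scale_linear_form (a : R) L : is_linear_form L ->
  is_linear_form (fun u => a * L u).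
Proof. by move=> hL c u v; rewrite hL; ring. Qed.

Lemma eq_bilinear_form B B' : (forall u v, B u v = B' u v) ->
  is_bilinear_form B' -> is_bilinear_form B.
Proof.
move=> BB' hB; rewrite (_ : B = B')//.
by apply/funext => u; apply/funext.
Qed.

Lemma add_bilinear_form B B' : is_bilinear_form B -> is_bilinear_form B' ->
  is_bilinear_form (fun u v => B u v + B' u v).
Proof.
move=> [Bl Br] [Bl' Br']; split=> [v|u] c w w'; first by rewrite Bl Bl'; ring.
by rewrite Br Br'; ring.
Qed.

Lemma scale_bilinear_form (a : R) B : is_bilinear_form B ->
  is_bilinear_form (fun u v => a * B u v).
Proof.
move=> [Bl Br]; split=> [v|u] c w w'; first by rewrite Bl; ring.
by rewrite Br; ring.
Qed.

Lemma sum_bilinear_form (I : Type) (s : seq I) (P : pred I)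
    (F : I -> U -> W -> R) : (forall i, is_bilinear_form (F i)) ->
  is_bilinear_form (fun u v => \sum_(i <- s | P i) F i u v).
Proof.
move=> hF; split=> [v|u] c w w'; rewrite mulr_sumr -big_split/=;
  by apply: eq_bigr => i _; have [Bl Br] := hF i; rewrite ?Bl ?Br.
Qed.

End Forms.

(** * Bilinearity and sign of the forms on the mesh *)

Section MeshForms.
Context {R : realType} {d : nat} (Om : set 'rV[R]_d) (Th : mesh R d).
Hypothesis hTh : is_triangulation Om Th.
Local Notation U := (broken_poly Th).
Implicit Types (u v : U) (e : face Th) (sigma : face Th -> R).

(** Common shape of the terms of the scheme: an integral [L] of a product of two polynomials that
    depend linearly on [u] and on [v]. *)
Lemma mul_bilinear_form (L : mpoly d R -> R) (P Q : U -> mpoly d R) :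
  is_linear_form L ->
  (forall (c : R) u v, P (c *: u + v) = c *: P u + P v) ->
  (forall (c : R) u v, Q (c *: u + v) = c *: Q u + Q v) ->
  is_bilinear_form (fun u v => L (P u * Q v)).
Proof.
move=> hL hP hQ; split=> [v|u] c w w'; rewrite -hL.
  by rewrite hP mulrDl -scalerAl.
by rewrite hQ mulrDr -scalerAr.
Qed.

Definition vol (K : 'I_(nelt Th)) (p : mpoly d R) : R :=
  volume_int (elt K) (peval p).

Lemma vol_linear K : is_linear_form (vol K).
Proof. by move=> c p q; apply: volume_int_linear; exact: tri_simplex hTh K. Qed.

Lemma vol_ge0 K p : (forall x, 0 <= peval p x) -> 0 <= vol K p.
Proof. exact: volume_int_ge0. Qed.

Lemma vol_sqr_eq0 K p : vol K (p * p) = 0 -> p = 0.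
Proof. by apply: volume_int_sqr_eq0; exact: tri_simplex hTh K. Qed.

Lemma peval_sum (I : Type) (s : seq I) (P : pred I) (F : I -> mpoly d R) x :
  peval (\sum_(i <- s | P i) F i) x = \sum_(i <- s | P i) peval (F i) x.
Proof. exact: raddf_sum. Qed.

Lemma ipE u v : ip u v = \sum_K vol K (u K * v K).
Proof.
apply: eq_bigr => K _; congr volume_int.
by apply/funext => x; rewrite pevalM.
Qed.

Lemma ip_bilinear : is_bilinear_form (@ip R d Th).
Proof.
apply: eq_bilinear_form ipE _.
apply: sum_bilinear_form => K; apply: mul_bilinear_form.
- exact: vol_linear.
- by move=> c u v; rewrite !ffunE.
- by move=> c u v; rewrite !ffunE.
Qed.

Lemma ip_ge0 u : 0 <= ip u u.
Proof.
rewrite ipE; apply: sumr_ge0 => K _; apply: vol_ge0 => x.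
by rewrite pevalM -expr2 sqr_ge0.
Qed.

Lemma ip_eq0 u : ip u u = 0 -> u = 0.
Proof.
rewrite ipE => uu0; apply/ffunP => K; rewrite ffunE; apply: (@vol_sqr_eq0 K).
move: K isT; apply: psumr_eq0P uu0 => K _; apply: vol_ge0 => x.
by rewrite pevalM -expr2 sqr_ge0.
Qed.

Lemma grad_ipE u v :
  grad_ip u v = \sum_K \sum_i vol K (mderiv i (u K) * mderiv i (v K)).
Proof.
apply: eq_bigr => K _; rewrite -linear_form_sum; last exact: vol_linear.
congr volume_int; apply/funext => x; rewrite peval_sum.
by apply: eq_bigr => i _; rewrite !mxE pevalM.
Qed.

Lemma grad_ip_bilinear : is_bilinear_form (@grad_ip R d Th).
Proof.
apply: eq_bilinear_form grad_ipE _.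
apply: sum_bilinear_form => K; apply: sum_bilinear_form => i.
apply: mul_bilinear_form.
- exact: vol_linear.
- by move=> c u v; rewrite !ffunE mderivD mderivZ.
- by move=> c u v; rewrite !ffunE mderivD mderivZ.
Qed.

Lemma grad_ip_ge0 u : 0 <= grad_ip u u.
Proof.
apply: sumr_ge0 => K _; apply: volume_int_ge0 => x; exact: dot_ge0.
Qed.

Definition face_val e (p : mpoly d R) : R := surface_int (face_pt e) (peval p).

Lemma face_val_linear e : is_linear_form (face_val e).
Proof. by move=> c p q; exact: surface_int_linear. Qed.

Definition jump_poly e u : mpoly d R := u (fst_elt e) - u (snd_elt e).

(** The normal is constant along a flat face, so the averaged normal derivative is again a
    polynomial. *)
Definition avg_dn_poly e u : mpoly d R :=
  (2^-1 : R) *: \sum_i normal e 0 i *: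
    (mderiv i (u (fst_elt e)) + mderiv i (u (snd_elt e))).

Lemma jump_polyE e u : jump e (pval u) = peval (jump_poly e u).
Proof. by apply/funext => x; apply/esym/mevalB. Qed.

Lemma avg_dn_polyE e u : avg e (pdn e u) = peval (avg_dn_poly e u).
Proof.
apply/funext => x; rewrite /avg /pdn -dotDr pevalZ mulrC; congr (_ * _).
by rewrite peval_sum; apply: eq_bigr => i _; rewrite !mxE pevalZ pevalD.
Qed.

Lemma jump_poly_linear e (c : R) u v :
  jump_poly e (c *: u + v) = c *: jump_poly e u + jump_poly e v.
Proof. by rewrite /jump_poly !ffunE scalerBr opprD addrACA. Qed.

Lemma avg_dn_poly_linear e (c : R) u v :
  avg_dn_poly e (c *: u + v) = c *: avg_dn_poly e u + avg_dn_poly e v.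
Proof.
have sCA (a b : R) (p : mpoly d R) : a *: (b *: p) = b *: (a *: p).
  by rewrite !scalerA mulrC.
rewrite /avg_dn_poly (sCA c) -scalerDr; congr (_ *: _).
rewrite scaler_sumr -big_split/=; apply: eq_bigr => i _.
by rewrite (sCA c) -scalerDr !ffunE !mderivD !mderivZ addrACA -[in LHS]scalerDr.
Qed.

Lemma face_ipE e p q : face_ip e (peval p) (peval q) = face_val e (p * q).
Proof. by congr surface_int; apply/funext => x; rewrite pevalM. Qed.

Lemma flux_jump_bilinear : is_bilinear_form (@flux_jump R d Om Th).
Proof.
apply: sum_bilinear_form => e.
apply: (eq_bilinear_form _ (fun u v =>
    face_val e (avg_dn_poly e u * jump_poly e v))) => [u v|].
  by rewrite jump_polyE avg_dn_polyE face_ipE.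
apply: mul_bilinear_form.
- exact: face_val_linear.
- exact: avg_dn_poly_linear.
- exact: jump_poly_linear.
Qed.

Lemma jh_bilinear sigma : is_bilinear_form (@jh R d Om Th sigma).
Proof.
apply: sum_bilinear_form => e.
apply: (eq_bilinear_form _ (fun u v => sigma e / face_diam e *
    face_val e (jump_poly e u * jump_poly e v))) => [u v|].
  by rewrite !jump_polyE face_ipE.
apply: scale_bilinear_form; apply: mul_bilinear_form.
- exact: face_val_linear.
- exact: jump_poly_linear.
- exact: jump_poly_linear.
Qed.

Lemma diam_ge0 (A : set 'rV[R]_d) : 0 <= diam A.
Proof.
rewrite /diam; set S := mkset _.
(* By convention [sup] is 0 on an empty or unbounded set. *)
have [[[r Sr] ubS]|/sup_out->//] := pselect (has_sup S).
apply: le_trans (ub_le_sup ubS Sr).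
by case: Sr => x [y [_ _ ->]]; exact: sqrtr_ge0.
Qed.

Lemma jh_ge0 (sigma0 : R) sigma u :
  0 < sigma0 -> penalty_above Om sigma0 sigma -> 0 <= jh Om sigma u u.
Proof.
move=> s0 hs; apply: sumr_ge0 => e /hs se; apply: mulr_ge0.
  by rewrite divr_ge0 ?diam_ge0// ltW// (lt_trans s0).
by apply: surface_int_ge0 => x; rewrite -expr2 sqr_ge0.
Qed.

Lemma ah_bilinear lambda sigma : is_bilinear_form (@ah R d Om Th lambda sigma).
Proof.
apply: add_bilinear_form; last exact: jh_bilinear.
apply: add_bilinear_form.
  apply: add_bilinear_form; first exact: grad_ip_bilinear.
  apply: (eq_bilinear_form _ (fun u v => -1 * flux_jump Om u v)) => [u v|].
    by rewrite mulN1r.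
  by apply: scale_bilinear_form; exact: flux_jump_bilinear.
apply: scale_bilinear_form.
(* The arguments of [flux_jump] are exchanged in the [lambda] term, so the two halves of bilinearity
   trade places. *)
by have [Bl Br] := flux_jump_bilinear; split.
Qed.

(* For lambda = -1, 0, 1 the form a_h(v, v) is respectively 2 Phi, the half sum
   of the broken energy and 2 Phi, and the broken energy itself. *)
Lemma ah_ge0 r (sigma0 : R) alpha lambda sigma u :
  coercivity_constants Om Th r sigma0 alpha ->
  [\/ lambda = -1, lambda = 0 | lambda = 1] ->
  penalty_above Om sigma0 sigma -> Vh r u -> 0 <= ah Om lambda sigma u u.
Proof.
move=> [s0 a0 co] hl hs hu; have := co _ hs _ hu.
have g0 := grad_ip_ge0 u; have j0 := jh_ge0 _ _ u s0 hs.
have := mulr_ge0 (ltW a0) (addr_ge0 g0 j0).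
by rewrite /ah /Phih; case: hl => ->; lra.
Qed.

End MeshForms.

(** * Monotone cubic equations *)

Section Combinations.
Context {R : realType} {U : lmodType R} {n : nat} (phi : 'I_n -> U).

Definition comb (x : 'rV[R]_n) : U := \sum_j x 0 j *: phi j.

Lemma comb_linear (c : R) x y : comb (c *: x + y) = c *: comb x + comb y.
Proof.
rewrite /comb scaler_sumr -big_split; apply: eq_bigr => j _.
by rewrite !mxE scalerDl scalerA.
Qed.

Lemma combD x y : comb (x + y) = comb x + comb y.
Proof. by have := comb_linear 1 x y; rewrite !scale1r. Qed.

Lemma comb0 : comb 0 = 0.
Proof. by apply: big1 => j _; rewrite mxE scale0r. Qed.

Lemma combZ (c : R) x : comb (c *: x) = c *: comb x.
Proof. by have := comb_linear c x 0; rewrite comb0 !addr0. Qed.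

Lemma linear_form_comb (L : U -> R) x : is_linear_form L ->
  L (comb x) = \sum_j x 0 j * L (phi j).
Proof.
move=> hL; rewrite linear_form_sum//; apply: eq_bigr => j _.
exact: linear_formZ.
Qed.

Lemma continuous_comb (L : 'I_n -> 'rV[R]_n -> R) :
  (forall j, continuous (L j)) ->
  continuous (fun x : 'rV[R]_n => \sum_j x 0 j * L j x).
Proof.
move=> cL; apply: continuous_sum => j; apply: continuous_mul => //.
exact: coord_continuous.
Qed.

Lemma continuous_linear_form (L : U -> R) : is_linear_form L ->
  continuous (fun x : 'rV[R]_n => L (comb x)).
Proof.
move=> hL; under eq_fun do rewrite linear_form_comb//.
by apply: continuous_comb => j; exact: cst_continuous.
Qed.

Lemma continuous_quadratic (B : U -> U -> R) : is_bilinear_form B ->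
  continuous (fun x : 'rV[R]_n => B (comb x) (comb x)).
Proof.
move=> [Bl Br].
under eq_fun => x do rewrite (linear_form_comb (B ^~ (comb x)))//.
by apply: continuous_comb => j; exact: continuous_linear_form.
Qed.

(** Norm comparison in finite dimension: the minimum on the compact unit sphere is positive, and
    homogeneity of degree 2 does the rest. The second hypothesis packs positivity and definiteness
    into one implication. *)
Lemma quadratic_lower_bound (N : U -> U -> R) : is_bilinear_form N ->
  (forall x : 'rV[R]_n, N (comb x) (comb x) <= 0 -> x = 0) ->
  exists2 m, 0 < m & forall x : 'rV[R]_n, m * `|x| ^+ 2 <= N (comb x) (comb x).
Proof.
move=> hN N0; have [Nl Nr] := hN.
have NZ (c : R) x : N (comb (c *: x)) (comb (c *: x)) =
    c ^+ 2 * N (comb x) (comb x).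
  rewrite combZ (linear_formZ (N ^~ _))// (linear_formZ (N _))//; ring.
pose S := [set x : 'rV[R]_n | `|x| = 1].
have [m m0 Sm] : exists2 m, 0 < m & forall x, S x -> m <= N (comb x) (comb x).
  (* The sphere is empty when [n] is 0, and then any positive constant serves. *)
  have [S0|S0] := pselect (S !=set0); last first.
    by exists 1 => // x Sx; exfalso; apply: S0; exists x.
  have cS : compact S.
    apply: bounded_closed_compact.
      exists 1; split; [exact: num_real|move=> M M1 x Sx].
      by apply: ltW; rewrite Sx.
    rewrite /S (_ : mkset _ =
      (fun x : 'rV[R]_n => `|x|) @^-1` [set y | y = 1])//.
    apply: preimage_closed; last exact: closed_eq.
    by move=> x _; exact: norm_continuous.
  have [z Sz minz] :=
    EVT_min_rV S0 cS (continuous_subspaceT (continuous_quadratic _ hN)).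
  exists (N (comb z) (comb z)); last by move=> x Sx; apply: minz; rewrite inE.
  rewrite ltNge; apply/negP => /N0 z0; move: Sz.
  by rewrite inE /S/= z0 normr0 => /esym/eqP; rewrite oner_eq0.
exists m => // x; have [->|x0] := eqVneq x 0.
  by rewrite normr0 expr0n mulr0 comb0 (linear_form0 (N 0)).
have nx0 : 0 < `|x| by rewrite normr_gt0.
have -> : N (comb x) (comb x) =
    `|x| ^+ 2 * N (comb (`|x|^-1 *: x)) (comb (`|x|^-1 *: x)).
  by rewrite NZ mulrA -exprMn divff ?gt_eqF// expr1n mul1r.
rewrite mulrC ler_pM2l ?exprn_gt0//; apply: Sm.
by rewrite /S/= normrZ gtr0_norm ?invr_gt0// mulVf ?gt_eqF.
Qed.

End Combinations.

(** [Z], [L], [Q] and [C] are the parts of degree 0, 1, 2 and 3 of [G] in [a]. Multilinearity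
    supplies the exact cubic expansion that [strongly_monotone_zero] asks for, and [N] measures the
    increment. *)
Lemma monotone_cubic_solvable (R : realType) (U : lmodType R) n
    (phi : 'I_n -> U) (Z : U -> R) (L N : U -> U -> R) (Q : U -> U -> U -> R)
    (C : U -> U -> U -> U -> R) (c : R) :
  let G a v := Z v + L a v + Q a a v + C a a a v in
  0 < c -> is_linear_form Z -> is_bilinear_form L -> is_bilinear_form N ->
  (forall a, is_bilinear_form (Q a)) ->
  (forall a v, is_linear_form (fun b => Q b a v)) ->
  (forall a b, is_bilinear_form (C a b)) ->
  (forall a b v, is_linear_form (fun z => C z a b v)) ->
  (forall a b v, is_linear_form (fun z => C a z b v)) ->
  (forall x : 'rV[R]_n, N (comb phi x) (comb phi x) <= 0 -> x = 0) ->
  (forall x h : 'rV[R]_n, c * N (comb phi h) (comb phi h) <=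
    G (comb phi x + comb phi h) (comb phi h) - G (comb phi x) (comb phi h)) ->
  exists x, forall i, G (comb phi x) (phi i) = 0.
Proof.
move=> G c0 hZ hL hN hQ hQ1 hC hC1 hC2 N0 mono.
have [m m0 Nm] := quadratic_lower_bound phi N hN N0.
pose s := comb phi.
have Gr a : is_linear_form (G a).
  move=> k u v; rewrite /G hZ hL.2 (hQ a).2 (hC a a).2; ring.
(* The coefficient of [t] in [G (a + t *: h) v]; [D2] below is that of $t^2$. [Q] and [C] are not
   assumed symmetric, so every slot contributes its own term. *)
pose D a h v := L h v + (Q a h v + Q h a v) +
  (C h a a v + C a h a v + C a a h v).
have Dl a v : is_linear_form (fun h => D a h v).
  move=> k u w; rewrite /D hL.1 (hQ a).1 hQ1 hC1 hC2 (hC a a).1; ring.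
pose D2 a h v := Q h h v + (C h h a v + C h a h v + C a h h v).
have GE a h v (t : R) : G (a + t *: h) v =
    G a v + t * D a h v + t ^+ 2 * D2 a h v + t ^+ 3 * C h h h v.
  have LE u : L (u + t *: h) v = L u v + t * L h v.
    by rewrite addrC hL.1 addrC.
  have QE u w : Q u (w + t *: h) v = Q u w v + t * Q u h v.
    by rewrite addrC (hQ u).1 addrC.
  have QE1 u w : Q (w + t *: h) u v = Q w u v + t * Q h u v.
    by rewrite addrC hQ1 addrC.
  have CE1 u w z : C (u + t *: h) w z v = C u w z v + t * C h w z v.
    by rewrite addrC hC1 addrC.
  have CE2 u w z : C w (u + t *: h) z v = C w u z v + t * C w h z v.
    by rewrite addrC hC2 addrC.
  have CE3 u w z : C w z (u + t *: h) v = C w z u v + t * C w z h v.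
    by rewrite addrC (hC w z).1 addrC.
  rewrite /G LE QE !QE1 CE3 !CE2 !CE1 /D /D2; ring.
pose F (x : 'rV[R]_n) : 'rV[R]_n := \row_i G (s x) (phi i).
have [||||x Fx] := @strongly_monotone_zero R n F (c * m).
- by rewrite mulr_gt0.
- move=> i; under eq_fun do rewrite mxE.
  have cQ : continuous (fun x : 'rV[R]_n => Q (s x) (s x) (phi i)).
    apply: (continuous_quadratic _ (fun a b => Q a b (phi i))).
    by split=> [b|a] k u w; rewrite ?hQ1// (hQ a).1.
  have cC : continuous (fun x : 'rV[R]_n => C (s x) (s x) (s x) (phi i)).
    under eq_fun do rewrite
      (linear_form_comb phi (fun a => C a (s _) (s _) (phi i)))//.
    apply: continuous_comb => j.
    apply: (continuous_quadratic _ (fun a b => C (phi j) a b (phi i))).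
    by split=> [b|a] k u w; rewrite ?hC2// (hC _ a).1.
  have cL : continuous (fun x : 'rV[R]_n => L (s x) (phi i)).
    by apply: (continuous_linear_form _ (fun a => L a (phi i))); exact: hL.1.
  by do 3!apply: continuous_add => //; exact: cst_continuous.
(* By linearity of [G] in the test argument, the dot product with [v] is the difference of the
   values of [G] at [s v]. *)
- move=> x v; rewrite -mulrA.
  apply: le_trans (_ : c * N (s v) (s v) <= _); first by rewrite ler_pM2l.
  apply: le_trans (mono x v) _; rewrite -/s -combD -/s.
  rewrite !(linear_form_comb phi _ v (Gr _)) -sumrB.
  rewrite le_eqVlt; apply/orP; left; apply/eqP.
  by apply: eq_bigr => i _; rewrite !mxE mulrBl !(mulrC (v 0 i)).
- move=> x; exists (\matrix_(i, j) D (s x) (phi i) (phi j)) => v.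
  exists (\row_j D2 (s x) (s v) (phi j)), (\row_j C (s v) (s v) (s v) (phi j)).
  move=> t; apply/rowP => j; rewrite !mxE /s combD combZ GE.
  rewrite (linear_form_comb phi (fun h => D _ h _) v)//.
  do 3!congr (_ + _); congr (_ * _).
  by apply: eq_bigr => i _; rewrite mxE.
by exists x => i; have /rowP/(_ i) := Fx; rewrite !mxE.
Qed.

(** * The time step *)

Section Basis.
Context {R : realType} {d : nat} (Th : mesh R d) (r : nat).
Local Notation U := (broken_poly Th).
Local Notation I := ('I_(nelt Th) * bmultinom d r.+1)%type.

(** In this form the degree bound is a family of linear conditions on the coefficients. *)
Lemma VhP (v : U) :
  Vh r v <-> forall K m, (r < mdeg m)%N -> mcoeff m (v K) = 0.
Proof.
split=> h K.
  move=> m rm; apply/eqP; move: (@msize_mdeg_ge d R (v K) m).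
  by rewrite mcoeff_msupp negbK; apply; exact: leq_trans (h K) rm.
rewrite msizeE; apply/bigmax_leqP_seq => m; rewrite mcoeff_msupp ltnS => vm _.
by rewrite leqNgt; apply: contra vm => rm; rewrite h.
Qed.

Lemma Vh_linear (c : R) (u v : U) : Vh r u -> Vh r v -> Vh r (c *: u + v).
Proof.
move=> /VhP hu /VhP hv; apply/VhP => K m rm.
by rewrite !ffunE mcoeffD mcoeffZ hu// hv// mulr0 addr0.
Qed.

(** One monomial carried by one element. [bmultinom] bounds the degree strictly, hence [r.+1] for
    degree at most [r]. *)
Definition basis_poly (j : 'I_#|{: I}|) : U :=
  [ffun K => if K == (enum_val j).1 then mpolyX R (enum_val j).2 else 0].

(** Coordinates are coefficients: this yields both the independence ([comb_eq0]) and the spanning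
    property ([Vh_combP]) of the basis. *)
Lemma mcoeff_comb x K (m : bmultinom d r.+1) :
  mcoeff m (comb basis_poly x K) = x 0 (enum_rank (K, m)).
Proof.
have -> : comb basis_poly x K = \sum_j x 0 j *: basis_poly j K.
  rewrite /comb; elim/big_rec2 : _ => [|j y z _ <-]; first by rewrite ffunE.
  by rewrite !ffunE.
rewrite raddf_sum (bigD1 (enum_rank (K, m)))//= mcoeffZ ffunE enum_rankK eqxx.
rewrite mcoeffX eqxx mulr1 big1 ?addr0// => j jKm.
rewrite mcoeffZ ffunE; case: eqVneq => [Kj|_]; last by rewrite mcoeff0 mulr0.
rewrite mcoeffX; case: eqVneq => [mj|_]; last by rewrite mulr0.
case/eqP: jKm; rewrite Kj -[LHS]enum_valK; congr enum_rank.
by case: (enum_val j) mj => /= K' m' mj; congr pair; exact: val_inj.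
Qed.

Lemma Vh_comb x : Vh r (comb basis_poly x).
Proof.
rewrite /comb; elim/big_rec : _ => [|j v _ hv].
  by apply/VhP => K m _; rewrite ffunE mcoeff0.
apply: Vh_linear => //; apply/VhP => K m rm; rewrite ffunE.
case: ifP => _; last by rewrite mcoeff0.
rewrite mcoeffX; case: eqVneq => // mE; move: rm.
by rewrite -mE ltnNge -ltnS bmdeg.
Qed.

Lemma comb_eq0 x : comb basis_poly x = 0 -> x = 0.
Proof.
move=> x0; apply/rowP => j; rewrite mxE -(enum_valK j).
case: (enum_val j) => K m.
by rewrite -mcoeff_comb x0 ffunE mcoeff0.
Qed.

Lemma Vh_combP v : Vh r v -> exists x, v = comb basis_poly x.
Proof.
move=> hv; pose c (j : I) := mcoeff j.2 (v j.1).
exists (\row_j c (enum_val j)).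
apply/ffunP => K; apply/mpolyP => m; have [rm|rm] := ltnP r (mdeg m).
  by rewrite (VhP _).1// ((VhP _).1 (Vh_comb _)).
rewrite -[m]/(bmnm (BMultinom (rm : (mdeg m < r.+1)%N))).
by rewrite mcoeff_comb mxE enum_rankK.
Qed.

End Basis.

(** * Solvability and uniqueness of one step *)

Section Scheme.
Context {R : realType} {d : nat} (Om : set 'rV[R]_d) (Th : mesh R d) (r : nat).
Context (sigma0 alpha lambda eps k : R) (sigma : face Th -> R).
Local Notation U := (broken_poly Th).
Implicit Types a b h u v : U.

Hypothesis hTh : is_triangulation Om Th.
Hypothesis hcoer : coercivity_constants Om Th r sigma0 alpha.
Hypothesis hlambda : [\/ lambda = -1, lambda = 0 | lambda = 1].
Hypothesis hsigma : penalty_above Om sigma0 sigma.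
Hypothesis eps0 : 0 < eps.
Hypothesis k0 : 0 < k.
Hypothesis hk : k < 2 * eps ^+ 2.

(** Sorts the scheme by degree in [a]: with [p], [q], [s], [t] standing for $a^3$, $a^2 b$, $a b^2$,
    $b^3$, the four summands on the right have degree 0, 1, 2 and 3. *)
Lemma linear_forms_residual (I A : U -> R) (c e : R) (a b p q s t : U) :
  is_linear_form I -> is_linear_form A ->
  I (c *: (a - b)) + A ((2^-1 : R) *: (a + b)) +
    e * I ((4^-1 : R) *: (p + q + s + t) - (2^-1 : R) *: (a + b)) =
  (- c * I b + 2^-1 * A b + e * (4^-1 * I t + - 2^-1 * I b)) +
  (c * I a + 2^-1 * A a + e * (4^-1 * I s + - 2^-1 * I a)) +
  e / 4 * I q + e / 4 * I p.
Proof.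
move=> hI hA; rewrite -(scaleN1r b) -(scaleN1r ((2^-1 : R) *: _)).
by rewrite !(linear_formD I)// !(linear_formZ I)// !(linear_formD I)//
  !(linear_formZ I)// (linear_formZ A)// (linear_formD A)//; ring.
Qed.

Definition residual b a v : R :=
  ip (k^-1 *: (a - b)) v + ah Om lambda sigma ((2^-1 : R) *: (a + b)) v
  + (eps ^+ 2)^-1 * ip (nonlin a b) v.

Definition gap : R := k^-1 - (eps ^+ 2)^-1 / 2.

Lemma gap_gt0 : 0 < gap.
Proof.
rewrite /gap subr_gt0 -invfM ltf_pV2 ?posrE// 1?mulrC//.
by rewrite mulr_gt0// exprn_gt0.
Qed.

Lemma nonlinE a b : nonlin a b =
  (4^-1 : R) *: (a * a * a + a * a * b + a * b * b + b * b * b)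
  - (2^-1 : R) *: (a + b).
Proof.
by apply/ffunP => K; rewrite !ffunE !exprS !expr0 !mulr1 !mulrA.
Qed.

Let ipl v : is_linear_form (fun u : U => ip u v).
Proof. by have [] := ip_bilinear Om Th hTh. Qed.

Let ahl v : is_linear_form (fun u : U => ah Om lambda sigma u v).
Proof. by have [] := ah_bilinear Om Th hTh lambda sigma. Qed.

(* f(a + h) - f(a) = h (((2a + h)^2 + (a + h + b)^2 + (a + b)^2) / 8 - 1/2) *)
Lemma nonlin_monotone a b h :
  - (2^-1 * ip h h) <= ip (nonlin (a + h) b) h - ip (nonlin a b) h.
Proof.
rewrite -subr_ge0.
(* Gathered under one integral, the integrand is $h^2$ times a sum of squares, so the inequality
   holds pointwise. *)
have -> : ip (nonlin (a + h) b) h - ip (nonlin a b) h - - (2^-1 * ip h h) =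
    ip ((2^-1 : R) *: h + ((-1) *: nonlin a b + nonlin (a + h) b)) h.
  rewrite !ipl; move: (ip (nonlin a b) h) (ip (nonlin (a + h) b) h) (ip h h).
  by move=> x y z; ring.
rewrite ipE; apply: sumr_ge0 => K _; apply: vol_ge0 => x.
rewrite !ffunE !exprS !expr0 !mulr1 !(pevalM, pevalD, pevalZ, pevalN).
move: (peval (a K) x) (peval (b K) x) (peval (h K) x) => A B H.
rewrite (_ : _ * _ = H ^+ 2 *
    ((2 * A + H) ^+ 2 + (A + H + B) ^+ 2 + (A + B) ^+ 2) / 8); last by field.
by rewrite divr_ge0// mulr_ge0 ?sqr_ge0// !addr_ge0 ?sqr_ge0.
Qed.

Lemma residual_monotone a b h : Vh r h ->
  gap * ip h h <= residual b (a + h) h - residual b a h.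
Proof.
move=> hh; have := nonlin_monotone a b h.
have := ah_ge0 Om Th r sigma0 alpha lambda sigma h hcoer hlambda hsigma hh.
have e0 : 0 < (eps ^+ 2)^-1 by rewrite invr_gt0 exprn_gt0.
rewrite /residual /gap; move: (eps ^+ 2)^-1 e0 => e e0.
have -> : k^-1 *: (a + h - b) = k^-1 *: h + k^-1 *: (a - b).
  by rewrite -scalerDr addrAC addrC.
have -> : (2^-1 : R) *: (a + h + b) = (2^-1 : R) *: h + (2^-1 : R) *: (a + b).
  by rewrite -scalerDr addrAC addrC.
rewrite ipl ahl => ah0; rewrite -subr_ge0 => /(mulr_ge0 (ltW e0)).
move: (ip (nonlin a b) h) (ip (nonlin (a + h) b) h) (ip h h) ah0.
move: (ip (k^-1 *: (a - b)) h) (ah _ _ _ _ _) (ah _ _ _ _ _) => x y z x' y' z'.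
by lra.
Qed.

Lemma step_exists b :
  exists a, Vh r a /\ scheme_step Om r lambda sigma eps k b a.
Proof.
pose e : R := (eps ^+ 2)^-1.
pose Z v := - k^-1 * ip b v + 2^-1 * ah Om lambda sigma b v
  + e * (4^-1 * ip (b * b * b) v + - 2^-1 * ip b v).
pose L a v := k^-1 * ip a v + 2^-1 * ah Om lambda sigma a v
  + e * (4^-1 * ip (a * b * b) v + - 2^-1 * ip a v).
pose Q a a' v := e / 4 * ip (a * a' * b) v.
pose C a a' a'' v := e / 4 * ip (a * a' * a'') v.
have residualE a v : residual b a v = Z v + L a v + Q a a v + C a a a v.
  rewrite /residual nonlinE.
  exact: (linear_forms_residual (fun u => ip u v) (fun u => ah _ _ _ u v)).
have mulZl (c : R) u u' w : (c *: u + u') * w = c *: (u * w) + u' * w.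
  by apply/ffunP => K; rewrite !ffunE mulrDl -scalerAl.
have mulZr (c : R) u u' w : w * (c *: u + u') = c *: (w * u) + w * u'.
  by apply/ffunP => K; rewrite !ffunE mulrDr -scalerAr.
have ipb : is_bilinear_form (@ip R d Th) := ip_bilinear Om Th hTh.
have ahb := ah_bilinear Om Th hTh lambda sigma.
have ipP (P : U -> U) :
    (forall (c : R) u u', P (c *: u + u') = c *: P u + P u') ->
    is_bilinear_form (fun a v => ip (P a) v).
  by move=> hP; split=> [v|u] c w w'; rewrite ?hP ?ipl ?ipb.2.
have ip1 w z : is_bilinear_form (fun a v => ip (a * w * z) v).
  by apply: (ipP (fun a => a * w * z)) => c u u'; rewrite !mulZl.
have ip2 w z : is_bilinear_form (fun a v => ip (w * a * z) v).
  by apply: (ipP (fun a => w * a * z)) => c u u'; rewrite mulZr mulZl.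
have ip3 w z : is_bilinear_form (fun a v => ip (w * z * a) v).
  by apply: (ipP (fun a => w * z * a)) => c u u'; rewrite mulZr.
have [|||||||||||x Fx] := @monotone_cubic_solvable R U _ (basis_poly Th r)
    Z L (@ip R d Th) Q C gap.
- exact: gap_gt0.
- apply: add_linear_form; [apply: add_linear_form|].
  + by apply: scale_linear_form; exact: ipb.2.
  + by apply: scale_linear_form; exact: ahb.2.
  + apply: scale_linear_form; apply: add_linear_form; apply: scale_linear_form;
      exact: ipb.2.
- apply: add_bilinear_form; [apply: add_bilinear_form|].
  + exact: scale_bilinear_form.
  + exact: scale_bilinear_form.
  + apply: scale_bilinear_form; apply: add_bilinear_form;
      exact: scale_bilinear_form.
- exact: ipb.
- by move=> a; apply: scale_bilinear_form; exact: ip2.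
- by move=> a v; apply: scale_linear_form; exact: (ip1 a b).1.
- by move=> a a'; apply: scale_bilinear_form; exact: ip3.
- by move=> a a' v; apply: scale_linear_form; exact: (ip1 a a').1.
- by move=> a a' v; apply: scale_linear_form; exact: (ip2 a a').1.
- move=> x xx0; apply: comb_eq0; apply: (ip_eq0 Om Th hTh).
  by apply/eqP; rewrite eq_le xx0 ip_ge0.
- move=> x h.
  have := residual_monotone (comb (basis_poly Th r) x) b _ (Vh_comb Th r h).
  by rewrite !residualE.
exists (comb (basis_poly Th r) x); split; first exact: Vh_comb.
(* The residual vanishes on the basis; linearity in the test function extends this to all of
   [Vh]. *)
move=> v /Vh_combP[y ->]; rewrite -/(residual b (comb _ x) (comb _ y)).
rewrite (linear_form_comb _ (residual b (comb _ x))).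
  by apply: big1 => j _; rewrite residualE Fx mulr0.
apply: add_linear_form; last by apply: scale_linear_form; exact: ipb.2.
by apply: add_linear_form; [exact: ipb.2|exact: ahb.2].
Qed.

(** Both equations are tested against [a' - a], so [residual_monotone] bounds [gap] times its
    squared norm by 0. *)
Lemma step_unique b a a' : Vh r a -> Vh r a' ->
  scheme_step Om r lambda sigma eps k b a ->
  scheme_step Om r lambda sigma eps k b a' -> a = a'.
Proof.
move=> ha ha' sa sa'; apply/esym/eqP; rewrite -subr_eq0; apply/eqP.
have hh : Vh r (a' - a) by rewrite addrC -scaleN1r; exact: Vh_linear.
apply: (ip_eq0 Om Th hTh); apply/eqP; rewrite eq_le ip_ge0 andbT.
rewrite -(pmulr_rle0 _ gap_gt0) (le_trans (residual_monotone a b _ hh))//.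
have ra : residual b a (a' - a) = 0 := sa _ hh.
have ra' : residual b a' (a' - a) = 0 := sa' _ hh.
by rewrite (addrC a) subrK ra ra' subrr.
Qed.

End Scheme.

Theorem theorem3p4 (R : realType) (d r : nat) (Om : set 'rV[R]_d)
    (Th : mesh R d) (kappa sigma0 alpha lambda eps T : R)
    (sigma : face Th -> R) (M : nat) (u0 : broken_poly Th)
    (hd : d = 2%N \/ d = 3%N) (hr : (1 <= r)%N)
    (hOm : polytopal_domain Om) (hTh : is_triangulation Om Th)
    (hkappa : quasi_uniform kappa Th)
    (hcoer : coercivity_constants Om Th r sigma0 alpha)
    (hlambda : [\/ lambda = -1, lambda = 0 | lambda = 1])
    (hsigma : penalty_above Om sigma0 sigma)
    (heps : 0 < eps) (hT : 0 < T) (hM : (0 < M)%N)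
    (hk : T / M%:R < 2 * eps ^+ 2) (hu0 : Vh r u0) :
  exists! u : 'I_M.+1 -> broken_poly Th,
    [/\ u ord0 = u0,
        forall m : 'I_M.+1, Vh r (u m) &
        forall m : 'I_M,
          scheme_step Om r lambda sigma eps (T / M%:R)
            (u (widen_ord (leqnSn M) m)) (u (lift ord0 m))].
Proof.
have k0 : 0 < T / M%:R by rewrite divr_gt0// ltr0n.
(* Solvability from every [b] gives a total successor map [f]; the discrete solution is the orbit of
   [u0] under it. *)
have [f fP] := choice (step_exists Om Th r sigma0 alpha lambda eps _ sigma
  hTh hcoer hlambda hsigma heps k0 hk).
exists (fun m => iter m f u0); split.
  split=> [//|m|m]; last exact: (fP _).2.
  by case: (m : nat) => [//|n]; exact: (fP _).1.
move=> u [uz uV us]; apply/funext => i.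
(* Induction runs on the value of the index, since the ordinal type is tied to [M]. *)
move: {2}(i : nat) (erefl (i : nat)) => n.
elim: n i => [|n IH] i iE.
  by rewrite iE -uz; congr u; exact/val_inj.
have nM : (n < M)%N by rewrite -ltnS -iE ltn_ord.
pose j : 'I_M := Ordinal nM.
have ij : i = lift ord0 j by apply: val_inj; rewrite /= /bump leq0n add1n.
have uj : iter n f u0 = u (widen_ord (leqnSn M) j) by rewrite -IH.
rewrite iE/= uj ij.
apply: (step_unique Om Th r sigma0 alpha lambda eps _ sigma
  hTh hcoer hlambda hsigma heps k0 hk (u (widen_ord (leqnSn M) j))).
- exact: (fP _).1.
- exact: uV.
- exact: (fP _).2.
- exact: us.
Qed.
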